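(* For any $\varepsilon>0$ and any sufficiently large $r>1$, if there exists an $r$-approximation algorithm for \textsc{Maximum Minimal Hitting Set} running in time $n^{(n/r)^{1-\varepsilon}}$, where $n$ is the number of vertices of the input hypergraph, then the randomized ETH is false.
   Context: Given a hypergraph $H=(V,E)$, a hitting set is a set $F\subseteq V$ intersecting every hyperedge; it is minimal if no proper subset of it is a hitting set. \textsc{Maximum Minimal Hitting Set}: given a hypergraph, find a minimal hitting set of maximum size. An $r$-approximation algorithm outputs a minimal hitting set of size at least $OPT/r$. Randomized ETH: there is $\delta>0$ such that no randomized (bounded-error) algorithm solves 3-SAT on $n$ variables in time $2^{\delta n}$. *)

(* Defs.v *)
From mathcomp Require Import all_boot all_order all_algebra.
From mathcomp Require Import reals exp.

Set Implicit Arguments.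
Unset Strict Implicit.
Unset Printing Implicit Defensive.
Import Order.TTheory GRing.Theory Num.Theory.
Local Open Scope ring_scope.

(** * Multi-tape probabilistic Turing machines *)

(* A tape cell holds a bit or is blank ([None]). *)
Definition symbol := option bool.

Inductive move := MoveLeft | MoveRight | Stay.

(* Two-way infinite tape: [(l, r)] has [l] to the left of the head (nearest cell
   first) and [r] from the head on; all cells not listed are blank. *)
Definition tape := (seq symbol * seq symbol)%type.

Definition scan (t : tape) : symbol := head None t.2.

Definition write (a : symbol) (t : tape) : tape := (t.1, a :: behead t.2).

Definition shift (m : move) (t : tape) : tape :=
  match m with
  | MoveLeft => (behead t.1, head None t.1 :: t.2)
  | MoveRight => (head None t.2 :: t.1, behead t.2)
  | Stay => t
  end.

(* The boolean argument of [tm_trans] is a fresh fair coin tossed at each step.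
   There are [tm_work] work tapes besides the tape [ord0], which holds the input
   initially and the output finally. *)
Record tm := TM {
  tm_work : nat;
  tm_state : finType;
  tm_start : tm_state;
  tm_halt : pred tm_state;
  tm_trans : tm_state -> {ffun 'I_tm_work.+1 -> symbol} -> bool ->
             tm_state * {ffun 'I_tm_work.+1 -> symbol * move}
}.

Definition deterministic (M : tm) : Prop :=
  forall (q : tm_state M) (a : {ffun 'I_(tm_work M).+1 -> symbol}) (b b' : bool),
    tm_trans q a b = tm_trans q a b'.

Definition config (M : tm) :=
  (tm_state M * ('I_(tm_work M).+1 -> tape))%type.

Definition init (M : tm) (x : seq bool) : config M :=
  (tm_start M, fun i => ([::], if i == ord0 then map Some x else [::])).

Definition halted (M : tm) (c : config M) : bool := tm_halt c.1.

Definition step (M : tm) (c : config M) (b : bool) : config M :=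
  if halted c then c else
  let: (q, act) := tm_trans c.1 [ffun i => scan (c.2 i)] b in
  (q, fun i => shift (act i).2 (write (act i).1 (c.2 i))).

(* The configuration reached on input [x] after [size w] steps, when the coin
   tosses are [w]. *)
Definition exec (M : tm) (x w : seq bool) : config M :=
  foldl (@step M) (init M x) w.

(* The output extends from the head of tape [ord0] to the first blank. *)
Fixpoint bits (s : seq symbol) : seq bool :=
  if s is Some b :: s' then b :: bits s' else [::].

Definition output (M : tm) (c : config M) : seq bool := bits (c.2 ord0).2.

Definition halts_within (M : tm) (x : seq bool) (t : nat) : Prop :=
  forall w : t.-tuple bool, halted (exec M x w).

(** * Randomized ETH *)

(* A literal is a variable with the value that makes it true. Literals may be
   repeated in a clause. *)
Definition literal (n : nat) := ('I_n * bool)%type.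
Definition clause (n : nat) := (3.-tuple (literal n))%type.

Definition satisfiable (n : nat) (phi : {set clause n}) : bool :=
  [exists a : {ffun 'I_n -> bool},
     [forall c in phi, has (fun l : literal n => a l.1 == l.2) c]].

Definition encode_literal (n : nat) (l : literal n) : seq bool :=
  l.2 :: [seq i == l.1 | i <- enum 'I_n].

Definition encode_cnf (n : nat) (cs : seq (clause n)) : seq bool :=
  nseq n true ++
  false :: flatten [seq flatten (map (@encode_literal n) c) | c : clause n <- cs].

(* On input [x], [M] halts within [t] steps whatever the coin tosses, and answers
   [b] with probability at least 2/3. *)
Definition decides_within (M : tm) (x : seq bool) (t : nat) (b : bool) : Prop :=
  halts_within M x t /\
  (2 * 2 ^ t <= 3 * #|[set w : t.-tuple bool | output (exec M x w) == [:: b]]|)%N.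

(* [M] solves 3-SAT on [n] variables in time [O(2 ^ (delta n))] with bounded
   error, whatever the order in which the clauses are listed. The clauses are
   distinct, so the length of the input is polynomial in [n]. *)
Definition solves_3SAT_in_time (R : realType) (delta : R) (M : tm) : Prop :=
  exists C : R, forall (n : nat) (phi : {set clause n}) (cs : seq (clause n)),
    perm_eq cs (enum phi) ->
    exists t : nat, t%:R <= C * 2 `^ (delta * n%:R) /\
      decides_within M (encode_cnf cs) t (satisfiable phi).

Definition randomized_ETH (R : realType) : Prop :=
  exists delta : R, 0 < delta /\ ~ exists M : tm, solves_3SAT_in_time delta M.

(** * Maximum Minimal Hitting Set *)

Section HittingSet.
Variable n : nat.
Implicit Types (E : {set {set 'I_n}}) (F : {set 'I_n}).

Definition hitting_set E F : bool := [forall e in E, F :&: e != set0].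

Definition minimal_hitting_set E F : bool := minset (hitting_set E) F.

Definition max_min_hitting_set E : nat :=
  (\max_(F : {set 'I_n} | minimal_hitting_set E F) #|F|)%N.

Definition encode_set F : seq bool := [seq i \in F | i <- enum 'I_n].

Definition encode_hypergraph (es : seq {set 'I_n}) : seq bool :=
  nseq n true ++ false :: flatten (map encode_set es).

End HittingSet.

(* [M] is an [r]-approximation algorithm whose running time on hypergraphs with
   [n] vertices is at most [T n], up to a factor polynomial in the length of the
   input. Without that factor no machine could even read all inputs, as the number
   of hyperedges can be exponential in [n]. Hyperedges are nonempty, since
   otherwise there is no hitting set. *)
Definition MMHS_approx_in_time (R : realType) (r : R) (T : nat -> R) (M : tm) : Prop :=
  deterministic M /\
  exists (C : R) (d : nat),
  forall (n : nat) (E : {set {set 'I_n}}) (es : seq {set 'I_n}),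
    (0 < n)%N -> set0 \notin E -> perm_eq es (enum E) ->
    let x := encode_hypergraph es in
    exists (t : nat) (F : {set 'I_n}),
      [/\ t%:R <= C * (size x)%:R ^+ d * T n,
          halts_within M x t,
          forall w : t.-tuple bool, output (exec M x w) = encode_set F,
          minimal_hitting_set E F
        & (max_min_hitting_set E)%:R / r <= #|F|%:R].

(* Main.v *)
Require Import Defs.
From mathcomp Require Import all_boot all_order all_algebra.
From mathcomp Require Import reals sequences exp.
From mathcomp Require Import zify ring lra.

(* The exponent bound is subexponential for every constant [r], so it suffices to
   reduce 3-SAT on [n] variables to a hypergraph with [O(n)] vertices, [2 ^ (delta' n)]
   hyperedges and gap more than [r]. Minimal hitting sets are the complements of maximal
   independent sets [I], and [v] is outside [I] exactly when some hyperedge [e] containing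
   [v] has the rest of [e] in [I]. Two facts come for free: independence is a universal
   constraint on [I], and exponentially many hyperedges may be used.

   The variables are cut into about [n / k] groups. For every function [h] from the
   assignments of a group to a set of size [A = 2 ^ a], every group has the vertices
   [(h, v)], and [(h, v)] in [I] is read as: the hash by [h] of the assignment of the group
   is [v]. Sets of such vertices that refute the three literals of a clause are hyperedges.
   A column vertex of position [h] may leave [I] only if every group has some [(h, v)] in
   [I]; this takes [A ^ (n / k)] hyperedges. If [phi] is satisfiable then all column
   vertices can be outside [I]. Conversely, two distinct assignments of a group agree on a
   fraction [1 / A] of the functions [h], so when more than this fraction of the columns
   leaves [I], every group has at most one consistent assignment, and these assignments
   satisfy [phi], since the hyperedges of a falsified clause would be inside [I]. Taking
   [A > 2 r] gives the gap.

   The reduction is a program in a language of stacks, whose loops are nested at most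
   three deep whatever [k] and [a] are, so that the exponent of its running time does not
   depend on the choice of [k]. *)

Set Implicit Arguments.
Unset Strict Implicit.
Unset Printing Implicit Defensive.

(** * Deterministic machines with an exit *)

Section Machines.
Variable K : nat.

Definition tapes := 'I_K.+1 -> tape.
Definition scans := {ffun 'I_K.+1 -> symbol}.
Definition actions := {ffun 'I_K.+1 -> symbol * move}.

(* The state [None] is the exit, so that machines can be chained. *)
Record mach := Mach {
  mstate : finType;
  mstart : option mstate;
  mtrans : mstate -> scans -> option mstate * actions
}.

Definition act_on (a : actions) (t : tapes) : tapes :=
  fun i => shift (a i).2 (write (a i).1 (t i)).

Definition scan_all (t : tapes) : scans := [ffun i => scan (t i)].

Definition mstep (M : mach) (c : option (mstate M) * tapes) :
    option (mstate M) * tapes :=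
  if c.1 is Some q then
    ((mtrans q (scan_all c.2)).1, act_on (mtrans q (scan_all c.2)).2 c.2)
  else c.

(** [n] is only an upper bound on the number of steps, so that branches of different lengths can
    share one cost. *)
Definition exits (M : mach) (c : option (mstate M)) (t : tapes) (n : nat)
    (t' : tapes) : Prop :=
  exists2 n', n' <= n & iter n' (@mstep M) (c, t) = (None, t').

Lemma iter_mstep_None (M : mach) (n : nat) (t : tapes) :
  iter n (@mstep M) (None, t) = (None, t).
Proof. by elim: n => //= n ->. Qed.

Lemma exits0 (M : mach) (t : tapes) n : exits (None : option (mstate M)) t n t.
Proof. by exists 0. Qed.

Lemma exits_leq (M : mach) (c : option (mstate M)) t n1 n2 t' :
  n1 <= n2 -> exits c t n1 t' -> exits c t n2 t'.
Proof. by move=> le [n' len E]; exists n' => //; apply: leq_trans len le. Qed.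

Lemma exits_step (M : mach) (q : mstate M) t n t' :
  exits (mtrans q (scan_all t)).1 (act_on (mtrans q (scan_all t)).2 t) n t' ->
  exits (Some q) t n.+1 t'.
Proof. by case=> n' len E; exists n'.+1 => //; rewrite iterSr. Qed.

(* A submachine [M1] embedded in [M], whose exit is rerouted to [x]. *)
Lemma exits_embed (M1 M : mach) (e : mstate M1 -> mstate M) (x : option (mstate M)) :
  (forall q s, mtrans (e q) s =
     (if (mtrans q s).1 is Some q' then Some (e q') else x, (mtrans q s).2)) ->
  forall n1 n2 c t t1 t2, exits c t n1 t1 -> exits x t1 n2 t2 ->
  exits (if c is Some q then Some (e q) else x) t (n1 + n2) t2.
Proof.
move=> eE n1 n2 c t t1 t2 [n len E] X.
apply: (exits_leq (leq_add len (leqnn n2))) => {n1 len}.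
elim: n c t E => [|n IHn] [q|] t.
- by [].
- by case=> ->.
- by rewrite iterSr /mstep /= => /IHn H; apply: exits_step; rewrite eE /=.
by rewrite iter_mstep_None => -[->]; apply: exits_leq X; rewrite leq_addl.
Qed.

Lemma exits_embed_exit (M1 M : mach) (e : mstate M1 -> mstate M) :
  (forall q s, mtrans (e q) s = (omap e (mtrans q s).1, (mtrans q s).2)) ->
  forall n c t t1, exits c t n t1 -> exits (omap e c) t n t1.
Proof.
move=> eE n c t t1 X; rewrite -(addn0 n).
have -> : omap e c = if c is Some q then Some (e q) else None by case: c {X}.
apply: exits_embed X (exits0 _ _ _) => q s; rewrite eE; by case: (_.1).
Qed.

Definition idle (s : scans) : actions := [ffun i => (s i, Stay)].

Definition act1 (i : 'I_K.+1) (x : symbol * move) (s : scans) : actions :=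
  [ffun j => if j == i then x else (s j, Stay)].

Definition mskip : mach :=
  @Mach unit None (fun _ s => (None, idle s)).

(** An action writes before it moves, so a push takes two steps: the head goes left, then the bit is
    written. *)
Definition mpush (i : 'I_K.+1) (b : bool) : mach :=
  @Mach bool (Some false) (fun q s =>
    if q then (None, act1 i (Some b, Stay) s)
    else (Some true, act1 i (s i, MoveLeft) s)).

Definition mseq (M1 M2 : mach) : mach :=
  @Mach (mstate M1 + mstate M2)%type
    (if mstart M1 is Some q then Some (inl q) else omap inr (mstart M2))
    (fun q s => match q with
     | inl q1 => (if (mtrans q1 s).1 is Some q' then Some (inl q')
                  else omap inr (mstart M2), (mtrans q1 s).2)
     | inr q2 => (omap inr (mtrans q2 s).1, (mtrans q2 s).2)
     end).

Definition mcase (i : 'I_K.+1) (M0 M1 M2 : mach) : mach :=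
  @Mach (unit + (mstate M0 + (mstate M1 + mstate M2)))%type
    (Some (inl tt))
    (fun q s => match q with
     | inl _ => match s i with
       | None => (omap (inr \o inl) (mstart M0), idle s)
       | Some true => (omap (inr \o (inr \o inl)) (mstart M1), act1 i (None, MoveRight) s)
       | Some false => (omap (inr \o (inr \o inr)) (mstart M2), act1 i (None, MoveRight) s)
       end
     | inr (inl q') => (omap (inr \o inl) (mtrans q' s).1, (mtrans q' s).2)
     | inr (inr (inl q')) =>
         (omap (inr \o (inr \o inl)) (mtrans q' s).1, (mtrans q' s).2)
     | inr (inr (inr q')) =>
         (omap (inr \o (inr \o inr)) (mtrans q' s).1, (mtrans q' s).2)
     end).

Definition mwhile (i : 'I_K.+1) (M1 M2 : mach) : mach :=
  @Mach (unit + (mstate M1 + mstate M2))%type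
    (Some (inl tt))
    (fun q s => match q with
     | inl _ => match s i with
       | None => (None, idle s)
       | Some true => (if mstart M1 is Some q' then Some (inr (inl q'))
                       else Some (inl tt), act1 i (None, MoveRight) s)
       | Some false => (if mstart M2 is Some q' then Some (inr (inr q'))
                        else Some (inl tt), act1 i (None, MoveRight) s)
       end
     | inr (inl q') => (if (mtrans q' s).1 is Some q'' then Some (inr (inl q''))
                        else Some (inl tt), (mtrans q' s).2)
     | inr (inr q') => (if (mtrans q' s).1 is Some q'' then Some (inr (inr q''))
                        else Some (inl tt), (mtrans q' s).2)
     end).

Lemma mseq_exits (M1 M2 : mach) t n1 t1 n2 t2 :
  exits (mstart M1) t n1 t1 -> exits (mstart M2) t1 n2 t2 ->
  exits (mstart (mseq M1 M2)) t (n1 + n2) t2.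
Proof.
move=> X1 X2; rewrite /mseq /=.
apply: (@exits_embed M1 (mseq M1 M2) inl) X1 _ => //.
exact: (@exits_embed_exit M2 (mseq M1 M2) inr).
Qed.

(** The coin is ignored, so the run on a given input is the same for all coin sequences. *)
Definition tm_of (M : mach) : tm :=
  @TM K (option (mstate M)) (mstart M) (pred1 None)
    (fun q s _ => if q is Some q' then mtrans q' s else (None, idle s)).

Lemma exec_tm_of (M : mach) (x w : seq bool) :
  exec (tm_of M) x w =
  iter (size w) (@mstep M) (mstart M, (init (tm_of M) x).2).
Proof.
rewrite /exec.
have -> : init (tm_of M) x = (mstart M, (init (tm_of M) x).2) by [].
move: (mstart M) (_.2) => q t.
elim: w q t => //= b w IHw q t.
rewrite -iterS iterSr; case: q => [q|] /=; last exact: IHw.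
rewrite /mstep /=; case E: (mtrans _ _) => [q' a] /=.
by rewrite -IHw; congr foldl; rewrite /step /halted /= E.
Qed.

End Machines.

(** * A stack language *)

(* Registers are stacks of bits, one per tape. [Case] and [While] pop the bit
   they branch on. *)
Inductive cmd :=
  | Skip
  | Push of nat & bool
  | Seq of cmd & cmd
  | Case of nat & cmd & cmd & cmd
  | While of nat & cmd & cmd.

Notation "c1 ;; c2" := (Seq c1 c2) (at level 60, right associativity).

Definition store := seq (seq bool).

Definition reg (s : store) (i : nat) : seq bool := nth [::] s i.
Definition upd (s : store) (i : nat) (w : seq bool) : store := set_nth [::] s i w.

Fixpoint loop (f : bool -> store -> option store) (i n : nat) (s : store) :
    option store :=
  if reg s i is b :: w then
    if n is n'.+1 then obind (loop f i n') (f b (upd s i w)) else None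
  else Some s.

(* Evaluation fails when a loop is iterated more than [B] times, so that its success
   bounds the running time (see [cost]). *)
Fixpoint ev (B : nat) (c : cmd) (s : store) {struct c} : option store :=
  match c with
  | Skip => Some s
  | Push i b => Some (upd s i (b :: reg s i))
  | Seq c1 c2 => obind (ev B c2) (ev B c1 s)
  | Case i c0 c1 c2 =>
      if reg s i is b :: w then
        if b then ev B c1 (upd s i w) else ev B c2 (upd s i w)
      else ev B c0 s
  | While i c1 c2 => loop (fun b => if b then ev B c1 else ev B c2) i B s
  end.

Fixpoint cost (B : nat) (c : cmd) : nat :=
  match c with
  | Skip => 0
  | Push _ _ => 2
  | Seq c1 c2 => cost B c1 + cost B c2
  | Case _ c0 c1 c2 => (cost B c0 + cost B c1 + cost B c2).+1
  | While _ c1 c2 => (B * (cost B c1 + cost B c2).+1).+1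
  end.

(** [K] bounds the registers and [d] the nesting depth of the loops, which becomes the degree of the
    running time. *)
Fixpoint fits (K d : nat) (c : cmd) : bool :=
  match c with
  | Skip => true
  | Push i _ => i <= K
  | Seq c1 c2 => fits K d c1 && fits K d c2
  | Case i c0 c1 c2 => [&& i <= K, fits K d c0, fits K d c1 & fits K d c2]
  | While i c1 c2 =>
      if d is d'.+1 then [&& i <= K, fits K d' c1 & fits K d' c2] else false
  end.

(** Only a loop multiplies the cost by [B]; code without loops, however long, affects the constant
    alone. Parameters expanded in the program text therefore leave the exponent unchanged. *)
Lemma cost_poly (K d : nat) (c : cmd) : fits K d c ->
  exists C, forall B, cost B c <= C * B.+1 ^ d.
Proof.
elim: c d => [|i b|c1 IH1 c2 IH2|i c0 IH0 c1 IH1 c2 IH2|i c1 IH1 c2 IH2] d /=.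
- by exists 0.
- by exists 2 => B; rewrite -{1}(muln1 2) leq_mul2l expn_gt0.
- case/andP=> /IH1 [C1 H1] /IH2 [C2 H2]; exists (C1 + C2) => B.
  by rewrite mulnDl leq_add.
- case/and4P=> _ /IH0 [C0 H0] /IH1 [C1 H1] /IH2 [C2 H2].
  exists (C0 + C1 + C2).+1 => B; rewrite mulSn !mulnDl -addn1 addnC.
  by rewrite leq_add ?expn_gt0 // !leq_add.
case: d => // d /and3P[_ /IH1 [C1 H1] /IH2 [C2 H2]].
exists (C1 + C2).+2 => B.
have := H1 B; have := H2 B; have : 0 < B.+1 ^ d by rewrite expn_gt0.
rewrite expnS; move: (B.+1 ^ d) (cost _ _) (cost _ _) => e x y; nia.
Qed.

Section Compilation.
Variable K : nat.

Fixpoint compile (c : cmd) : mach K :=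
  match c with
  | Skip => mskip K
  | Push i b => mpush (inord i) b
  | Seq c1 c2 => mseq (compile c1) (compile c2)
  | Case i c0 c1 c2 => mcase (inord i) (compile c0) (compile c1) (compile c2)
  | While i c1 c2 => mwhile (inord i) (compile c1) (compile c2)
  end.

(** Compilation is proved for an abstract representation, because programs run under a strict one
    before the call of the approximation machine and under a loose one after it. *)
Variable rep : tape -> seq bool -> Prop.
Hypothesis rep_scan : forall t w, rep t w -> scan t = ohead w.
Hypothesis rep_pop :
  forall t b w, rep t (b :: w) -> rep (shift MoveRight (write None t)) w.
Hypothesis rep_push : forall t b w, rep t w ->
  rep (write (Some b) (shift MoveLeft (write (scan t) t))) (b :: w).
Hypothesis rep_idle : forall t w, rep t w -> rep (write (scan t) t) w.

Definition represents (t : tapes K) (s : store) : Prop :=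
  forall i : 'I_K.+1, rep (t i) (reg s i).

Lemma represents_idle t s :
  represents t s -> represents (act_on (idle (scan_all t)) t) s.
Proof. by move=> H i; rewrite /act_on !ffunE /=; apply: rep_idle. Qed.

Lemma represents_pop t s i b w : i <= K -> represents t s -> reg s i = b :: w ->
  represents (act_on (act1 (inord i) (None, MoveRight) (scan_all t)) t) (upd s i w).
Proof.
move=> iK H E j; rewrite /act_on !ffunE /reg /upd nth_set_nth /= -val_eqE /= inordK //.
case: eqP => [ji|_] /=; last exact: rep_idle.
by apply: (@rep_pop _ b); rewrite -E -ji; apply: H.
Qed.

Lemma represents_push t s i b : i <= K -> represents t s ->
  let t1 := act_on (act1 (inord i) (scan (t (inord i)), MoveLeft) (scan_all t)) t in
  represents (act_on (act1 (inord i) (Some b, Stay) (scan_all t1)) t1)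
    (upd s i (b :: reg s i)).
Proof.
move=> iK H t1 j.
rewrite /t1 /act_on !ffunE /reg /upd nth_set_nth /= -val_eqE /= inordK //.
case: eqP => [ji|_] /=; last by do 2!apply: rep_idle.
have -> : inord i = j by apply/val_inj; rewrite /= inordK.
by rewrite -ji; apply/rep_push/H.
Qed.

Lemma compile_exits (B d : nat) (c : cmd) (s s' : store) (t : tapes K) :
  fits K d c -> ev B c s = Some s' -> represents t s ->
  exists2 t', exits (mstart (compile c)) t (cost B c) t' & represents t' s'.
Proof.
elim: c d s s' t => [|i b|c1 IH1 c2 IH2|i c0 IH0 c1 IH1 c2 IH2|i c1 IH1 c2 IH2] d s s' t.
- by move=> _ [<-] H; exists t => //; apply: exits0.
- move=> /= iK [<-] H; eexists; last exact: represents_push H.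
  apply: exits_step => /=; apply: exits_step => /=.
  by rewrite {1}/scan_all ffunE; apply: exits0.
- move=> /= /andP[f1 f2]; case E1: (ev B c1 s) => [s1|] //= E2 H.
  have [t1 X1 H1] := IH1 _ _ _ _ f1 E1 H.
  have [t2 X2 H2] := IH2 _ _ _ _ f2 E2 H1.
  by exists t2 => //; apply: mseq_exits X1 X2.
- case/and4P=> iK f0 f1 f2 /= E H.
  have sc : scan_all t (inord i) = ohead (reg s i).
    by rewrite ffunE; have /rep_scan := H (inord i); rewrite inordK.
  case Ei: (reg s i) E sc => [|[] w] E sc.
  + have [t' X H'] := IH0 _ _ _ _ f0 E (represents_idle H).
    exists t' => //; apply: exits_step => /=; rewrite sc /=.
    apply: (@exits_leq _ _ _ _ (cost B c0)); first by lia.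
    exact: (@exits_embed_exit _ (compile c0) (compile (Case i c0 c1 c2)) (inr \o inl)) X.
  + have [t' X H'] := IH1 _ _ _ _ f1 E (represents_pop iK H Ei).
    exists t' => //; apply: exits_step => /=; rewrite sc /=.
    apply: (@exits_leq _ _ _ _ (cost B c1)); first by lia.
    exact: (@exits_embed_exit _ (compile c1) (compile (Case i c0 c1 c2)) (inr \o (inr \o inl))) X.
  have [t' X H'] := IH2 _ _ _ _ f2 E (represents_pop iK H Ei).
  exists t' => //; apply: exits_step => /=; rewrite sc /=.
  apply: (@exits_leq _ _ _ _ (cost B c2)); first by lia.
  exact: (@exits_embed_exit _ (compile c2) (compile (Case i c0 c1 c2)) (inr \o (inr \o inr))) X.
case: d => // d /and3P[iK f1 f2] /=.
(* The induction is on the fuel of the loop and the matching factor of its cost; the [B] inside the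
   bodies stays fixed. *)
elim: {3 4}B s t => [|n IHn] s t /= E H.
  have sc : scan_all t (inord i) = ohead (reg s i).
    by rewrite ffunE; have /rep_scan := H (inord i); rewrite inordK.
  move: E sc; case Ei: (reg s i) => [|b w] // [<-] sc.
  eexists; last exact: (represents_idle H).
  by apply: exits_step => /=; rewrite sc /=; apply: exits0.
have sc : scan_all t (inord i) = ohead (reg s i).
  by rewrite ffunE; have /rep_scan := H (inord i); rewrite inordK.
move: E sc; case Ei: (reg s i) => [|b w].
  move=> [<-] sc; eexists; last exact: (represents_idle H).
  by apply: exits_step => /=; rewrite sc /=; apply: exits0.
case Eb: (_ (upd s i w)) => [s1|] //= E sc.
have H1 := represents_pop iK H Ei.
case: b Ei Eb sc => Ei Eb sc.
  have [t1 X1 {}H1] := IH1 _ _ _ _ f1 Eb H1.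
  have [t2 X2 H2] := IHn _ _ E H1.
  exists t2 => //; apply: exits_step => /=; rewrite sc /=.
  have /(_ (Some (inl tt))) Y := @exits_embed K (compile c1)
    (compile (While i c1 c2)) (inr \o inl).
  apply: (@exits_leq _ _ _ _ (cost B c1 + (n * (cost B c1 + cost B c2).+1).+1)); first by lia.
  by apply: Y X1 X2.
have [t1 X1 {}H1] := IH2 _ _ _ _ f2 Eb H1.
have [t2 X2 H2] := IHn _ _ E H1.
exists t2 => //; apply: exits_step => /=; rewrite sc /=.
have /(_ (Some (inl tt))) Y := @exits_embed K (compile c2)
  (compile (While i c1 c2)) (inr \o inr).
apply: (@exits_leq _ _ _ _ (cost B c2 + (n * (cost B c1 + cost B c2).+1).+1)); first by lia.
by apply: Y X1 X2.
Qed.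

End Compilation.

(** * Stacks on tapes *)

(** Lists that differ only in trailing blanks describe the same half of a tape. *)
Definition same_cells (r r' : seq symbol) : Prop :=
  forall j, nth None r j = nth None r' j.

Definition same_tape (t t' : tape) : Prop :=
  same_cells t.1 t'.1 /\ same_cells t.2 t'.2.

Lemma same_cells_cons a r r' : same_cells r r' -> same_cells (a :: r) (a :: r').
Proof. by move=> H [|j] /=. Qed.

Lemma same_cells_head r r' : same_cells r r' -> head None r = head None r'.
Proof. by move=> /(_ 0); rewrite !nth0. Qed.

Lemma same_cells_behead r r' : same_cells r r' -> same_cells (behead r) (behead r').
Proof. by move=> H j; rewrite !nth_behead. Qed.

Lemma same_tape_step a m t t' :
  same_tape t t' -> same_tape (shift m (write a t)) (shift m (write a t')).
Proof.
case: t t' => [l r] [l' r'] [/= H1 H2]; have H3 := same_cells_behead H2.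
case: m; split=> //=.
- exact: same_cells_behead.
- by rewrite (same_cells_head H1); do 2!apply: same_cells_cons.
- exact: same_cells_cons.
- exact: same_cells_cons.
Qed.

Lemma same_cells_bits r r' : same_cells r r' -> bits r = bits r'.
Proof.
elim: r r' => [|a r IH] [|a' r'] H //=.
- by have := H 0; move=> /= <-.
- by have := H 0; move=> /= ->.
have /= -> := H 0; case: a' H => // b H; congr cons; apply: IH => j.
exact: (H j.+1).
Qed.

Lemma bits_map_Some w : bits (map Some w) = w.
Proof. by elim: w => //= b w ->. Qed.

(** Nothing but [w] is on the tape: the approximation machine must find blank work tapes. After its
    run only [stack] can be claimed, since symbols may remain on the left or beyond the first
    blank. *)
Definition clean_stack (t : tape) (w : seq bool) : Prop :=
  same_tape t ([::], map Some w).

Definition stack (t : tape) (w : seq bool) : Prop := bits t.2 = w.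

Lemma clean_stackW t w : clean_stack t w -> stack t w.
Proof. by case=> _ /same_cells_bits; rewrite bits_map_Some. Qed.

Lemma stack_scan t w : stack t w -> scan t = ohead w.
Proof. by case: t => l [|[b|] r] <-. Qed.

Lemma stack_pop t b w : stack t (b :: w) -> stack (shift MoveRight (write None t)) w.
Proof. by case: t => l [|[b'|] r] //= [_ <-]. Qed.

Lemma stack_push t b w : stack t w ->
  stack (write (Some b) (shift MoveLeft (write (scan t) t))) (b :: w).
Proof. by case: t => l [|[b'|] r] <-. Qed.

Lemma stack_idle t w : stack t w -> stack (write (scan t) t) w.
Proof. by case: t => l [|[b'|] r] <-. Qed.

Lemma clean_stack_scan t w : clean_stack t w -> scan t = ohead w.
Proof. by move/clean_stackW/stack_scan. Qed.

Lemma same_tape_trans t1 t2 t3 : same_tape t1 t2 -> same_tape t2 t3 -> same_tape t1 t3.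
Proof. by move=> [H1 H2] [H3 H4]; split=> j; [rewrite H1 H3|rewrite H2 H4]. Qed.

Lemma clean_stack_pop t b w :
  clean_stack t (b :: w) -> clean_stack (shift MoveRight (write None t)) w.
Proof.
move/(same_tape_step None MoveRight) => H; apply: same_tape_trans H _.
by split=> //= -[|[|j]].
Qed.

Lemma clean_stack_push t b w : clean_stack t w ->
  clean_stack (write (Some b) (shift MoveLeft (write (scan t) t))) (b :: w).
Proof.
move=> H; rewrite (clean_stack_scan H).
have := same_tape_step (Some b) Stay (same_tape_step (ohead w) MoveLeft H).
move=> {}H; apply: same_tape_trans H _; split=> //= j.
by case: j => [|j] //=; case: w => [|b' w] //=; case: j => [|[]].
Qed.

Lemma same_tape_idle t : same_tape (write (scan t) t) t.
Proof. by case: t => l [|a r] //; split=> // -[|[]]. Qed.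

Lemma clean_stack_idle t w : clean_stack t w -> clean_stack (write (scan t) t) w.
Proof. by move=> H; apply: same_tape_trans H; apply: same_tape_idle. Qed.

(** * Running a machine on some of the tapes *)

Section Lift.
Variables (K : nat) (M : tm) (f : 'I_(tm_work M).+1 -> 'I_K.+1).
Hypothesis f_inj : injective f.

Definition running (q : tm_state M) : option (tm_state M) :=
  if tm_halt q then None else Some q.

(** The coin is fixed to [true]. The simulated machine halts with the same output for all coin
    sequences, in particular for the constant one. *)
Definition mlift : mach K :=
  @Mach K (tm_state M) (running (tm_start M)) (fun q s =>
    let p := tm_trans q [ffun i => s (f i)] true in
    (running p.1,
     [ffun j => if [pick i | f i == j] is Some i then p.2 i else (s j, Stay)])).

Lemma mlift_steps (n : nat) (c : config M) (t : tapes K) :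
  (forall i, same_tape (t (f i)) (c.2 i)) ->
  let c' := foldl (@step M) c (nseq n true) in
  exists t', [/\ iter n (@mstep K mlift) (running c.1, t) = (running c'.1, t'),
    forall i, same_tape (t' (f i)) (c'.2 i) &
    forall j, (forall i, f i != j) -> bits (t' j).2 = bits (t j).2].
Proof.
elim: n c t => [|n IHn] c t H /=; first by exists t.
rewrite -iterS iterSr.
have [t1 [H1 H2 H3]] : exists t1,
    [/\ mstep (M := mlift) (running c.1, t) = (running (step c true).1, t1),
    forall i, same_tape (t1 (f i)) ((step c true).2 i) &
    forall j, (forall i, f i != j) -> bits (t1 j).2 = bits (t j).2].
  rewrite /mstep /step /running /halted /=; case: ifP => hc /=.
    by exists t; rewrite hc; split.
  have -> : [ffun i => scan_all t (f i)] = [ffun i => scan (c.2 i)].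
    by apply/ffunP=> i; rewrite !ffunE; apply: same_cells_head; case: (H i).
  case: (tm_trans _ _ _) => q a /=; eexists; split; first by [].
    move=> i; rewrite /act_on ffunE; case: pickP => [i' /eqP/f_inj -> |/(_ i)].
      exact: same_tape_step.
    by rewrite eqxx.
  move=> j Hj; rewrite /act_on ffunE; case: pickP => [i' E|_].
    by move: (Hj i'); rewrite E.
  rewrite ffunE /=; exact: stack_idle.
have [t2 [H4 H5 H6]] := IHn _ _ H2.
exists t2; split=> //; first by rewrite H1 H4.
by move=> j Hj; rewrite H6 // H3.
Qed.

Lemma mlift_exits (x y : seq bool) (n : nat) (t : tapes K) :
  halts_within M x n -> (forall w : n.-tuple bool, output (exec M x w) = y) ->
  (forall i, clean_stack (t (f i)) (if i == ord0 then x else [::])) ->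
  exists t', [/\ exits (mstart mlift) t n t', stack (t' (f ord0)) y &
    forall j, (forall i, f i != j) -> bits (t' j).2 = bits (t j).2].
Proof.
move=> hM oM H.
have Hi i : same_tape (t (f i)) ((init M x).2 i).
  by have := H i; rewrite /init /clean_stack /=; case: eqP.
have [t' [H1 H2 H3]] := mlift_steps n Hi.
exists t'; split=> //.
  exists n => //; rewrite H1; have := hM (nseq_tuple n true).
  by rewrite /halted /running /exec /= => ->.
have := oM (nseq_tuple n true); rewrite /output /exec /= => <-.
by apply: same_cells_bits; case: (H2 ord0).
Qed.

End Lift.

(** * Verification of stack programs *)

Definition For (i : nat) (f : bool -> cmd) : cmd := While i (f true) (f false).
Definition CaseB (i : nat) (c0 : cmd) (f : bool -> cmd) : cmd :=
  Case i c0 (f true) (f false).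
Definition Clear (i : nat) : cmd := For i (fun _ => Skip).
Definition Move (i j : nat) : cmd := For i (fun b => Push j b).

(** Like [PopW] and [SeqAll] below, this is expanded in the program text and adds no loop. *)
Definition PushW (i : nat) (w : seq bool) : cmd :=
  foldr (fun b c => Push i b ;; c) Skip w.

(* Missing bits are read as [false]. *)
Fixpoint PopW (i n : nat) (f : seq bool -> cmd) : cmd :=
  if n is n'.+1 then
    CaseB i (PopW i n' (fun u => f (false :: u)))
            (fun b => PopW i n' (fun u => f (b :: u)))
  else f [::].

Definition SeqAll (T : Type) (f : T -> cmd) (l : seq T) : cmd :=
  foldr (fun x c => f x ;; c) Skip l.

Lemma fits_Seq K d c1 c2 : fits K d (c1 ;; c2) = fits K d c1 && fits K d c2.
Proof. by []. Qed.

Lemma fits_CaseB K d i c0 f : fits K d (CaseB i c0 f) =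
  [&& i <= K, fits K d c0, fits K d (f true) & fits K d (f false)].
Proof. by []. Qed.

Lemma fits_For K d i f :
  fits K d.+1 (For i f) = [&& i <= K, fits K d (f true) & fits K d (f false)].
Proof. by []. Qed.

Lemma fits_PushW K d i w : i <= K -> fits K d (PushW i w).
Proof. by move=> iK; elim: w => //= b w ->; rewrite iK. Qed.

Lemma fits_PopW K d i n f : i <= K -> (forall u, fits K d (f u)) -> fits K d (PopW i n f).
Proof.
by move=> iK; elim: n f => [|n IHn] f H //=; rewrite iK !IHn // => u; apply: H.
Qed.

Lemma fits_SeqAll K d T (f : T -> cmd) l :
  (forall x, fits K d (f x)) -> fits K d (SeqAll f l).
Proof. by move=> H; elim: l => //= x l ->; rewrite H. Qed.

Arguments upd : simpl never.
Arguments reg : simpl never.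

(* Registers are reused: [rLEN] holds the [n + 1] marks of the length of a literal, then
   the marks that count the values of the binary counter [rY], and finally the threshold. *)
Definition rY := 0.
Definition rLEN := 1.
Definition rLEN2 := 2.
Definition rTMP := 3.
Definition rL1 := 4.
Definition rL2 := 5.
Definition rL3 := 6.
Definition rFLG := 7.
Definition rFND := 8.
Definition rEDGE := 9.
Definition rEDGE2 := 10.
Definition rY1 := 11.
Definition rOUT := 12.

Ltac st := rewrite /upd /reg /rY /rLEN /rLEN2 /rTMP /rL1 /rL2 /rL3
  /rFLG /rFND /rEDGE /rEDGE2 /rY1 /rOUT /=.

Section WP.
Variable B : nat.

(** Running out of fuel counts as failure, so a proof of [wp] also bounds the running time. *)
Definition wp (c : cmd) (Q : store -> Prop) (s : store) : Prop :=
  if ev B c s is Some s' then Q s' else False.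

Lemma wp_seq c1 c2 Q s : wp c1 (wp c2 Q) s -> wp (c1 ;; c2) Q s.
Proof. by rewrite /wp /=; case: (ev B c1 s). Qed.

Lemma wp_push i b (Q : store -> Prop) s : Q (upd s i (b :: reg s i)) -> wp (Push i b) Q s.
Proof. by []. Qed.

Lemma wp_case_nil i c0 f Q s : reg s i = [::] -> wp c0 Q s -> wp (CaseB i c0 f) Q s.
Proof. by rewrite /wp /= => ->. Qed.

Lemma wp_case_cons i c0 f Q s b w : reg s i = b :: w -> wp (f b) Q (upd s i w) ->
  wp (CaseB i c0 f) Q s.
Proof. by rewrite /wp /= => ->; case: b. Qed.

Lemma wp_mono c (Q Q' : store -> Prop) s :
  wp c Q s -> (forall s', Q s' -> Q' s') -> wp c Q' s.
Proof. by rewrite /wp; case: (ev B c s) => // s' H /(_ _ H). Qed.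

(** The ghost list [l] stands for the iterations still to come; its length provides the fuel, and
    the invariant ties it to the store. *)
Lemma wp_for (T : Type) (l : seq T) (Inv : seq T -> store -> Prop) i f Q s :
  size l <= B -> Inv l s ->
  (forall s, Inv [::] s -> reg s i = [::] /\ Q s) ->
  (forall x l s, Inv (x :: l) s ->
     exists b w, reg s i = b :: w /\ wp (f b) (Inv l) (upd s i w)) ->
  wp (For i f) Q s.
Proof.
move=> lB I0 Inil Icons; rewrite /wp /=.
elim: l {1 4}B s lB I0 => [|x l IHl] n s lB Is.
  by have [E Qs] := Inil _ Is; case: n {lB} => [|n] /=; rewrite E.
case: n lB => // n lB; have [b [w [E W]]] := Icons _ _ _ Is.
rewrite /= E; move: W; rewrite /wp; case: b {E}; case: (ev _ _ _) => //= s' /IHl; exact.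
Qed.

Lemma upd_id (s : store) i : i < size s -> upd s i (reg s i) = s.
Proof.
rewrite /upd /reg => is_; apply: (@eq_from_nth _ [::]).
  by rewrite size_set_nth; apply/maxn_idPr.
by move=> j _; rewrite nth_set_nth /=; case: eqP => [->|].
Qed.

Lemma updC (s : store) i j v w : i != j -> upd (upd s i v) j w = upd (upd s j w) i v.
Proof. by move=> /negPf ij; rewrite /upd set_set_nth ij. Qed.

Lemma upd2 (s : store) i v w : upd (upd s i v) i w = upd s i w.
Proof. by rewrite /upd set_set_nth eqxx. Qed.

Lemma reg_upd (s : store) i j v : reg (upd s i v) j = if j == i then v else reg s j.
Proof. by rewrite /reg /upd nth_set_nth. Qed.

Lemma size_upd (s : store) i v : i < size s -> size (upd s i v) = size s.
Proof. by move=> is_; rewrite size_set_nth; apply/maxn_idPr. Qed.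

Lemma wp_clear i Q s : i < size s -> size (reg s i) <= B -> Q (upd s i [::]) ->
  wp (Clear i) Q s.
Proof.
move=> si sB Qs.
apply: (@wp_for _ (reg s i) (fun l s' => s' = upd s i l)) => //.
- by rewrite upd_id.
- by move=> _ ->; rewrite reg_upd eqxx.
by move=> b l _ ->; exists b, l; rewrite reg_upd eqxx /wp /= upd2.
Qed.

Lemma wp_move i j Q s : i != j -> i < size s -> j < size s -> size (reg s i) <= B ->
  Q (upd (upd s i [::]) j (catrev (reg s i) (reg s j))) -> wp (Move i j) Q s.
Proof.
move=> ij si sj sB Qs.
pose Inv l s' := exists2 v, s' = upd (upd s i l) j v &
  catrev l v = catrev (reg s i) (reg s j).
apply: (@wp_for _ (reg s i) Inv) => //.
- by exists (reg s j) => //; rewrite upd_id // upd_id.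
- by move=> _ [v -> /= ->]; rewrite !reg_upd (negPf ij) eqxx.
move=> b l _ [v -> E]; exists b, l; rewrite !reg_upd (negPf ij) eqxx; split=> //.
rewrite /wp /=; exists (b :: v) => //.
by rewrite (@updC _ j i) 1?eq_sym // upd2 reg_upd eqxx upd2.
Qed.

Lemma wp_pushW i w Q s : i < size s -> Q (upd s i (catrev w (reg s i))) ->
  wp (PushW i w) Q s.
Proof.
elim: w s => [|b w IHw] s si /=; first by rewrite upd_id.
move=> H; apply: wp_seq; apply: IHw; first by rewrite size_upd.
by rewrite upd2 reg_upd eqxx.
Qed.

Lemma wp_popW i n f Q s : i < size s ->
  wp (f (mkseq (nth false (reg s i)) n)) Q (upd s i (drop n (reg s i))) ->
  wp (PopW i n f) Q s.
Proof.
elim: n f s => [|n IHn] f s si; first by rewrite drop0 upd_id.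
rewrite /mkseq /= -[1]addn0 iotaDl -map_comp /wp /=.
case E: (reg s i) => [|b w] H.
  apply: IHn => //; rewrite E; congr wp: H; congr (f (_ :: _)).
  by apply: eq_map => j; rewrite /= !nth_nil.
have {}H : wp (f (b :: mkseq (nth false w) n)) Q (upd s i (drop n w)) by [].
by case: b {E} H => H; apply: IHn; rewrite ?size_upd // reg_upd eqxx upd2.
Qed.

Lemma wp_seqall (T : Type) (Inv : seq T -> store -> Prop) (f : T -> cmd) l s :
  (forall x l s, Inv (x :: l) s -> wp (f x) (Inv l) s) ->
  Inv l s -> wp (SeqAll f l) (Inv [::]) s.
Proof.
move=> H; elim: l s => [|x l IHl] s //= Is; apply: wp_seq.
by apply: wp_mono (H _ _ _ Is) _.
Qed.

(** Each of the two passes reverses the word, so its order is restored. *)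
Definition Copy (i j : nat) : cmd :=
  Move i rTMP ;; For rTMP (fun b => Push i b ;; Push j b).

Lemma wp_copy i j Q s : i != rTMP -> j != rTMP -> i != j ->
  i < size s -> j < size s -> rTMP < size s -> size (reg s i) <= B ->
  reg s rTMP = [::] -> reg s j = [::] -> Q (upd s j (reg s i)) -> wp (Copy i j) Q s.
Proof.
move=> iT jT ij si sj sT sB eT ej Qs; apply: wp_seq; apply: wp_move => //.
rewrite eT -[catrev _ _]/(rev _); set w := reg s i in sB Qs *.
pose Inv l s' := exists2 v, s' = upd (upd (upd s rTMP l) i v) j v & catrev l v = w.
apply: (@wp_for _ (rev w) Inv); rewrite ?size_rev //.
- exists [::]; last by rewrite -[catrev _ _]/(rev _) revK.
  by rewrite (updC _ _ _ iT) -ej (@updC _ i j) // (@updC _ rTMP j) 1?eq_sym // upd_id.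
- move=> _ [v -> E]; rewrite -[v]/(catrev [::] v) E.
  rewrite (@reg_upd _ j) eq_sym (negPf jT) reg_upd eq_sym (negPf iT) reg_upd eqxx.
  by split=> //; rewrite -{1}eT upd_id // {1}/w upd_id.
move=> b l _ [v -> E]; exists b, l.
split; first by rewrite !reg_upd eq_sym (negPf jT) eq_sym (negPf iT) eqxx.
apply: wp_seq; rewrite /wp /=; exists (b :: v) => //.
have TI : rTMP != i by rewrite eq_sym.
have TJ : rTMP != j by rewrite eq_sym.
have ji : j != i by rewrite eq_sym.
rewrite (@updC _ j rTMP) // (@updC _ i rTMP) // upd2.
by rewrite !reg_upd (negPf ij) (negPf ji) !eqxx (@updC _ j i) // upd2 upd2.
Qed.
End WP.

(** * Building a duplicate-free list of words *)

(** The encoding of a hypergraph lists every hyperedge once, whereas the reduction may generate the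
    same word several times. *)
Definition ins (es : seq (seq bool)) (e : seq bool) : seq (seq bool) :=
  if e \in es then es else e :: es.

Lemma size_foldl_ins l es : size (foldl ins es l) <= size es + size l.
Proof.
elim: l es => [|e l IHl] es /=; first by rewrite addn0.
apply: leq_trans (IHl _) _; rewrite /ins; case: ifP => _ /=; lia.
Qed.

Lemma mem_foldl_ins l es e : (e \in foldl ins es l) = (e \in es) || (e \in l).
Proof.
elim: l es => [|e' l IHl] es /=; first by rewrite in_nil orbF.
rewrite IHl inE /ins; case: ifP => [E|_]; last by rewrite inE orbA (orbC (e == e')).
by case: eqP => [->|]; rewrite ?E ?orbT.
Qed.

Lemma uniq_foldl_ins l es : uniq es -> uniq (foldl ins es l).
Proof.
elim: l es => [|e' l IHl] es //= U; apply: IHl.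
by rewrite /ins; case: ifP => //= ->.
Qed.

Definition all_size (N : nat) (es : seq (seq bool)) : Prop :=
  forall e, e \in es -> size e = N.

Lemma all_size_foldl_ins N l es :
  all_size N es -> all_size N l -> all_size N (foldl ins es l).
Proof. by move=> H1 H2 e; rewrite mem_foldl_ins => /orP[/H1|/H2]. Qed.

Lemma size_flatten_all N es : all_size N es -> size (flatten es) = N * size es.
Proof.
elim: es => [|e es IH] H; first by rewrite muln0.
rewrite /= size_cat H ?mem_head // IH ?mulnS // => e' He'.
by apply: H; rewrite inE He' orbT.
Qed.

(** One scan of [rOUT] compares [rEDGE] with all words: its bits pass to [rEDGE2] and are restored
    at the end of each word. [rFLG] records a mismatch in the current word, [rFND] that some word
    was equal. This keeps the nesting depth at two. *)
Definition Insert : cmd :=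
  For rOUT (fun b =>
    CaseB rEDGE Skip (fun c =>
      (if b == c then Skip else Push rFLG true) ;; Push rEDGE2 c) ;;
    Push rTMP b ;;
    CaseB rEDGE
      (Move rEDGE2 rEDGE ;; CaseB rFLG (Push rFND true) (fun _ => Clear rFLG))
      (fun c => Push rEDGE c)) ;;
  Move rTMP rOUT ;;
  CaseB rFND (Move rEDGE rEDGE2 ;; Move rEDGE2 rOUT)
    (fun _ => Clear rFND ;; Clear rEDGE).

Section Programs.
Variable B : nat.

Lemma wp_insert N es e y x x2 l1 l2 l3 y1 Q :
  0 < N -> size e = N -> all_size N es -> N <= B -> N * size es <= B ->
  Q [:: y; x; x2; [::]; l1; l2; l3; [::]; [::]; [::]; [::]; y1; flatten (ins es e)] ->
  wp B Insert Q
    [:: y; x; x2; [::]; l1; l2; l3; [::]; [::]; e; [::]; y1; flatten es].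
Proof.
move=> N0 Ne Nes NB esB HQ; apply: wp_seq.
(* [es1] has been compared and [rs] has not, except for the prefix [p] of its first word; [u] and
   [v] are the parts of [e] read and unread. As [v] is nonempty, a word is closed as soon as its
   last bit is read. *)
pose Inv l s := exists es1 rs p u v flg fnd,
  [/\ es = es1 ++ rs, p ++ l = flatten rs, e = u ++ v, size p = size u & v != [::] /\
     [/\ (flg == [::]) = (p == u), size flg <= size p,
         (fnd == [::]) = (e \notin es1), size fnd <= size es1 &
     s = [:: y; x; x2; rev (flatten es1 ++ p); l1; l2; l3; flg; fnd; v; rev u; y1; l]]].
have esN : size es <= N * size es by rewrite -{1}[size es]mul1n leq_mul2r N0 orbT.
apply: (@wp_for _ _ (flatten es) Inv).
- by rewrite (size_flatten_all Nes).
- exists [::], es, [::], [::], e, [::], [::]; split=> //; split=> //.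
  by rewrite -size_eq0 Ne -lt0n.
- move=> s [es1 [rs [p [u [v [flg [fnd [E1 E2 E3 E4 [v0 [E5 E6 E7 E8 ->]]]]]]]]]].
  have rs0 : rs = [::].
    case: rs E1 E2 => // r rs E1 /(congr1 size); rewrite cats0 /= size_cat E4.
    have -> : size r = N by apply: Nes; rewrite E1 mem_cat mem_head orbT.
    by rewrite -Ne E3 size_cat; case: v v0 {E3} => //= a v _; lia.
  split=> //; move: E1 E2; rewrite rs0 !cats0 /= => E1 p0.
  rewrite -E1 p0 in E4 E5 E6 E7 E8 *.
  have u0 : u = [::] by apply: size0nil; rewrite -E4.
  rewrite u0 eqxx /= in E3 E5 *; rewrite -E3 (eqP E5) cats0.
  apply: wp_seq; apply: wp_move => //.
    by st; rewrite size_rev (size_flatten_all Nes).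
  st; rewrite -[catrev _ _]/(rev _) revK.
  case: fnd E7 E8 => [|b fnd] /= E7 E8.
    apply: wp_case_nil => //; apply: wp_seq.
    apply: wp_move => //; first by st; rewrite Ne.
    st; apply: wp_move => //; first by st; rewrite size_rev Ne.
    by st; rewrite catrevE revK; move: HQ; rewrite /ins -if_neg -E7.
  apply: wp_case_cons => //; st.
  apply: wp_seq; apply: wp_clear => //; first by st; lia.
  st; apply: wp_clear => //; first by st; rewrite Ne.
  by st; move: HQ; rewrite /ins; move/negbFE: (esym E7) => ->.
move=> b l s [es1 [rs [p [u [v [flg [fnd [E1 E2 E3 E4 [v0 [E5 E6 E7 E8 ->]]]]]]]]]].
exists b, l; split=> //; st; apply: wp_seq.
case: v E3 v0 => // c v E3 _.
case: rs E1 E2 => [|r rs] E1 E2; first by case: p E2 {E4 E5 E6}.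
have rN : size r = N by apply: Nes; rewrite E1 mem_cat mem_head orbT.
have Er : r = rcons p b ++ drop (size p).+1 r.
  rewrite -[LHS](cat_take_drop (size p).+1); congr cat.
  have pr : (size p).+1 <= size r by rewrite rN -Ne E3 size_cat /=; lia.
  transitivity (take (size p).+1 (r ++ flatten rs)); first by rewrite takel_cat.
  by rewrite -[r ++ _]E2 -cat_rcons -(size_rcons p b) take_size_cat.
have El : l = drop (size p).+1 r ++ flatten rs.
  by move: E2; rewrite /= {1}Er -cat_rcons -catA => /eqP; rewrite eqseq_cat // => /andP[_ /eqP].
set flg' := if b == c then flg else true :: flg.
have F1 : (flg' == [::]) = (rcons p b == rcons u c).
  by rewrite /flg' eqseq_rcons -E5; case: (b == c); rewrite ?andbT ?andbF.
have F2 : size flg' <= size (rcons p b).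
  by rewrite /flg' size_rcons; case: ifP => _ /=; rewrite ?ltnS // leqW.
suff W : wp B (Push rTMP b;;
   CaseB rEDGE (Move rEDGE2 rEDGE;; CaseB rFLG (Push rFND true) (fun=> Clear rFLG))
     (fun c0 : bool => Push rEDGE c0)) (Inv l)
  [:: y; x; x2; rev (flatten es1 ++ p); l1; l2; l3; flg'; fnd; v; rev (rcons u c); y1; l].
  rewrite rev_rcons in W.
  apply: wp_case_cons => //; st; apply: wp_seq.
  by move: W; rewrite /flg'; case: (b == c) => W; do ?[apply: wp_seq]; apply: wp_push; st.
apply: wp_seq; apply: wp_push; st.
rewrite -rev_rcons rcons_cat.
case: v E3 => [|c' v] E3 /=; last first.
  apply: wp_case_cons => //; st; apply: wp_push; st.
  suff: Inv l [:: y; x; x2; rev (flatten es1 ++ rcons p b); l1; l2; l3; flg'; fnd;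
    c' :: v; rev (rcons u c); y1; l].
    by [].
  exists es1, (r :: rs), (rcons p b), (rcons u c), (c' :: v), flg', fnd.
  by split=> //; rewrite ?cat_rcons ?size_rcons ?E4.
have re : rcons u c = e by rewrite E3 cats1.
have r0 : drop (size p).+1 r = [::].
  by apply/eqP; rewrite -size_eq0 size_drop rN -Ne -re size_rcons E4 subnn.
rewrite r0 cats0 in Er; rewrite r0 /= in El.
have {}E1 : es = rcons es1 r ++ rs by rewrite cat_rcons.
have fl : flatten es1 ++ rcons p b = flatten (rcons es1 r).
  by rewrite -Er -cats1 flatten_cat /= cats0.
apply: wp_case_nil => //; apply: wp_seq; apply: wp_move => //.
  by st; rewrite size_rev re Ne.
st; rewrite -[catrev _ _]/(rev _) revK re fl.
have es1B : size (rcons es1 r) <= B by apply: leq_trans esB; move: esN; rewrite E1 size_cat; lia.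
have W fnd' : (fnd' == [::]) = (e \notin rcons es1 r) -> size fnd' <= size (rcons es1 r) ->
  Inv l [:: y; x; x2; rev (flatten (rcons es1 r)); l1; l2; l3; [::]; fnd'; e; [::]; y1; l].
  move=> G1 G2; exists (rcons es1 r), rs, [::], [::], e, [::], fnd'; rewrite cats0.
  by split=> //; split=> //; rewrite -size_eq0 Ne -lt0n.
case: flg' F1 F2 => [|f flg'] F1 F2.
  apply: wp_case_nil => //; apply: wp_push; st; apply: W; rewrite ?size_rcons //= mem_rcons inE.
  by move: F1; rewrite -Er re eqxx => /esym/eqP <-; rewrite eqxx.
apply: wp_case_cons => //; st; apply: wp_clear => //.
  by st; move: F2; rewrite -Er rN /=; lia.
st; apply: W; last by rewrite size_rcons; lia.
rewrite mem_rcons inE negb_or E7; move: F1; rewrite -Er re => /esym.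
by rewrite eq_sym => ->.
Qed.

(** The nested [PopW] branch on all contents of the three blocks, so [F] and [bad] can be arbitrary
    functions, tabulated in the program text. The bit popped by [For] is pushed back, and the loop
    runs once per block of [rL1]. *)
Definition Trans (j : nat) (F : seq bool -> seq bool -> seq bool -> seq bool)
    (bad : seq bool -> seq bool -> seq bool -> bool) : cmd :=
  For rL1 (fun b => Push rL1 b ;;
    PopW rL1 j (fun u1 => PopW rL2 j (fun u2 => PopW rL3 j (fun u3 =>
      (if bad u1 u2 u3 then Push rFLG true else Skip) ;;
      PushW rTMP (F u1 u2 u3))))).

Definition blk (j : nat) (l : seq bool) (g : nat) : seq bool :=
  mkseq (fun i => nth false l (g * j + i)) j.

Lemma blk_drop j l g : mkseq (nth false (drop (g * j) l)) j = blk j l g.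
Proof. by apply: eq_map => i; rewrite nth_drop. Qed.

Lemma wp_trans j F bad m y x x2 l1 l2 l3 fnd edge edge2 y1 out Q :
  0 < j -> size l1 <= m * j < size l1 + j -> size l2 <= size l1 -> size l3 <= size l1 ->
  m <= B ->
  (forall flg, size flg <= m ->
    (flg != [::]) = has (fun g => bad (blk j l1 g) (blk j l2 g) (blk j l3 g)) (iota 0 m) ->
   Q [:: y; x; x2;
         rev (flatten (mkseq (fun g => F (blk j l1 g) (blk j l2 g) (blk j l3 g)) m));
         [::]; [::]; [::]; flg; fnd; edge; edge2; y1; out]) ->
  wp B (Trans j F bad) Q
    [:: y; x; x2; [::]; l1; l2; l3; [::]; fnd; edge; edge2; y1; out].
Proof.
move=> j0 /andP[jm1 jm2] s21 s31 mB HQ.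
pose W n := flatten (mkseq (fun g => F (blk j l1 g) (blk j l2 g) (blk j l3 g)) n).
pose Inv (l : seq nat) s := exists g flg, [/\ g + size l = m, size flg <= g,
  (flg != [::]) = has (fun g => bad (blk j l1 g) (blk j l2 g) (blk j l3 g)) (iota 0 g) &
  s = [:: y; x; x2; rev (W g);
   drop (g * j) l1; drop (g * j) l2; drop (g * j) l3; flg; fnd; edge; edge2; y1; out]].
apply: (@wp_for _ _ (iota 0 m) Inv).
- by rewrite size_iota.
- by exists 0, [::]; rewrite size_iota mul0n !drop0.
- move=> s [g [flg [/= gm E1 E2 ->]]]; rewrite addn0 in gm; rewrite gm in E1 E2 *.
  st; rewrite !drop_oversize ?(leq_trans _ jm1) //; split=> //; exact: HQ.
move=> z l s [g [flg [/= gm E1 E2 ->]]].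
have gl : g * j < size l1.
  have : g * j + j <= m * j by rewrite -mulSnr leq_mul2r; lia.
  lia.
case E: (drop (g * j) l1) => [|b w].
  by move: (congr1 size E); rewrite size_drop /=; lia.
exists b, w; split=> //.
apply: wp_seq; apply: wp_push; st; rewrite -E.
apply: wp_popW => //; st; apply: wp_popW => //; st; apply: wp_popW => //; st.
rewrite !blk_drop !drop_drop -mulSn; apply: wp_seq.
set u1 := blk _ _ _; set u2 := blk _ _ _; set u3 := blk _ _ _.
set flg' := if bad u1 u2 u3 then true :: flg else flg.
suff H : Inv l [:: y; x; x2; catrev (F u1 u2 u3) (rev (W g)); drop (g.+1 * j) l1;
     drop (g.+1 * j) l2; drop (g.+1 * j) l3; flg'; fnd; edge; edge2; y1; out].
  by move: H; rewrite /flg'; case: ifP => _ H; [apply: wp_push; st|]; apply: wp_pushW.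
exists g.+1, flg'; split.
- by rewrite -gm addSnnS.
- by rewrite /flg'; case: ifP => _ //=; rewrite leqW.
- rewrite -addn1 iotaD has_cat /= add0n orbF -E2 /flg'.
  by rewrite -/u1 -/u2 -/u3; case: ifP => _; rewrite ?orbT ?orbF.
by rewrite catrevE -rev_cat /W /mkseq -(addn1 g) iotaD map_cat flatten_cat /= cats0.
Qed.

(** With [pol = false] a word is dropped when some block raises the flag, as for clauses; with
    [pol = true] it is kept only then, as for columns. *)
Definition Emit (pol : bool) (j : nat) F bad : cmd :=
  Trans j F bad ;; Move rTMP rEDGE ;;
  CaseB rFLG (if pol then Clear rEDGE else Insert)
    (fun _ => Clear rFLG ;; if pol then Insert else Clear rEDGE).

Lemma wp_emit pol j F bad m y x x2 l1 l2 l3 y1 N es Q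
    (e := flatten (mkseq (fun g => F (blk j l1 g) (blk j l2 g) (blk j l3 g)) m)) :
  0 < j -> size l1 <= m * j < size l1 + j -> size l2 <= size l1 -> size l3 <= size l1 ->
  0 < N -> size e = N -> all_size N es -> m <= N -> N <= B -> N * size es <= B ->
  Q [:: y; x; x2; [::]; [::]; [::]; [::]; [::]; [::]; [::]; [::]; y1;
    flatten (if has (fun g => bad (blk j l1 g) (blk j l2 g) (blk j l3 g)) (iota 0 m) == pol
             then ins es e else es)] ->
  wp B (Emit pol j F bad) Q
    [:: y; x; x2; [::]; l1; l2; l3; [::]; [::]; [::]; [::]; y1; flatten es].
Proof.
move=> j0 jm s21 s31 N0 eN Nes mN NB esB HQ.
apply: wp_seq; apply: (wp_trans j0 jm s21 s31); first by lia.
move=> flg sflg Eflg; apply: wp_seq; apply: wp_move => //.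
  by st; rewrite size_rev -/e eN.
st; rewrite -[catrev _ _]/(rev _) revK -/e; rewrite -Eflg in HQ.
case: flg sflg {Eflg} HQ => [|f flg] /= sflg HQ.
  apply: wp_case_nil => //; case: pol HQ => HQ.
    by apply: wp_clear => //; st; rewrite ?eN.
  exact: (wp_insert N0).
apply: wp_case_cons => //; st; apply: wp_seq; apply: wp_clear => //; st; first by lia.
case: pol HQ => HQ; first exact: (wp_insert N0).
by apply: wp_clear => //; st; rewrite ?eN.
Qed.

End Programs.

(** * Binary counters *)

Fixpoint incr (w : seq bool) : seq bool :=
  if w is b :: w' then if b then false :: incr w' else true :: w' else [::].

Fixpoint value (w : seq bool) : nat := if w is b :: w' then b + (value w').*2 else 0.

Lemma size_incr w : size (incr w) = size w.
Proof. by elim: w => //= -[] w //= ->. Qed.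

Lemma value_lt w : value w < 2 ^ size w.
Proof. by elim: w => //= b w; rewrite expnS; case: b; lia. Qed.

Lemma value_incr w : (value w).+1 < 2 ^ size w -> value (incr w) = (value w).+1.
Proof.
elim: w => //= b w IHw; rewrite expnS; case: b => //= H.
by rewrite IHw; lia.
Qed.

Lemma value_inj w w' : size w = size w' -> value w = value w' -> w = w'.
Proof.
elim: w w' => [|b w IHw] [|b' w'] //= [sz] E.
have [-> V] : b = b' /\ value w = value w' by case: b E; case: b' => E; split=> //; lia.
by rewrite (IHw w').
Qed.

Lemma value_zero l : value (nseq l false) = 0.
Proof. by elim: l => //= l ->. Qed.

(** Before overflow the [i]-th iterate has value [i], and [value] is injective on words of equal
    length. *)
Lemma mem_traject_incr l w : size w = l -> w \in traject incr (nseq l false) (2 ^ l).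
Proof.
move=> sw; have lt := value_lt w; rewrite sw in lt.
apply/trajectP; exists (value w) => //.
have S i : size (iter i incr (nseq l false)) = l.
  by elim: i => [|i IH]; rewrite ?size_nseq //= size_incr.
have V i : i < 2 ^ l -> value (iter i incr (nseq l false)) = i.
  elim: i => [|i IH] il; first by rewrite value_zero.
  by rewrite /= value_incr IH ?S //; apply: ltnW.
by apply: value_inj; rewrite ?S ?V.
Qed.

(** * The program of the reduction *)

(** The [n] leading bits and the separator give [n + 1] marks, the length of an encoded literal. At
    the separator the remaining input is moved away, which ends the loop. *)
Definition Parse : cmd :=
  For rY (fun b => if b then Push rLEN true else Push rLEN true ;; Move rY rTMP) ;;
  Move rTMP rY.

Definition ReadLit (L : nat) : cmd :=
  For rLEN (fun _ => Push rLEN2 true ;; CaseB rY1 Skip (fun b => Push rTMP b)) ;;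
  Move rLEN2 rLEN ;; Move rTMP L.

(* The sign of a literal is replaced with [false], so that the blocks contain only
   the position of the variable. *)
Definition ClauseStep (k : nat) F (bad : bool -> bool -> bool -> _) : cmd :=
  ReadLit rL1 ;; ReadLit rL2 ;; ReadLit rL3 ;;
  CaseB rL1 Skip (fun s1 => Push rL1 false ;;
  CaseB rL2 Skip (fun s2 => Push rL2 false ;;
  CaseB rL3 Skip (fun s3 => Push rL3 false ;; Emit false k F (bad s1 s2 s3)))).

Definition ClausePass (k : nat) F bad : cmd :=
  Copy rY rY1 ;; For rY1 (fun b => Push rY1 b ;; ClauseStep k F bad).

(** Popping the [n + 1] marks [k] at a time makes one round per group. A round supplies the [a1]
    bits of one counter digit, as many marks for [Powers], and one mark for the group. *)
Definition Prepare (k a1 : nat) : cmd :=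
  Clear rY ;;
  For rLEN (fun b => Push rLEN b ;; PopW rLEN k (fun _ =>
    PushW rY (nseq a1 false) ;; PushW rL3 (nseq a1 true) ;; Push rY1 true)).

(** One doubling per bit of the counter, so that the later loop on [rLEN] visits all its values. *)
Definition Powers : cmd :=
  Push rLEN true ;;
  For rL3 (fun _ => For rLEN (fun _ => Push rLEN2 true ;; Push rLEN2 true) ;;
                    Move rLEN2 rLEN).

Definition Increment : cmd :=
  Push rFLG true ;;
  For rY (fun b => CaseB rFLG (Push rTMP b) (fun _ =>
    if b then Push rFLG true ;; Push rTMP false else Push rTMP true)) ;;
  Clear rFLG ;; Move rTMP rY.

(** Since [rOUT] is a stack, the unary number of vertices is pushed last. The same loop over the
    groups prepares the threshold for [Decide]. *)
Definition Header (KV theta : nat) : cmd :=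
  Clear rY ;; Push rOUT false ;;
  For rY1 (fun _ => PushW rOUT (nseq KV true) ;; PushW rLEN (nseq theta true)).

(** * Loop nesting and correctness of the reduction program *)

Section Reduction.
Variables (k a1 KV theta : nat) (TT HT : eqType) (taus : seq TT) (hcs : seq HT).
Variable F1 : TT -> seq bool -> seq bool -> seq bool -> seq bool.
Variable bad1 : TT -> bool -> bool -> bool -> seq bool -> seq bool -> seq bool -> bool.
Variable F2 : HT -> seq bool -> seq bool.
Variable flag2 : seq bool -> bool.

Definition ColumnPass (hc : HT) : cmd :=
  Copy rY rL1 ;; Emit true a1 (fun u _ _ => F2 hc u) (fun u _ _ => flag2 u).

(** [taus] and [hcs] will depend only on [k] and [a], and are enumerated in the program text;
    clauses, groups and counter values grow with the input and are handled by loops. *)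
Definition Reduce : cmd :=
  Parse ;; SeqAll (fun tau => ClausePass k (F1 tau) (bad1 tau)) taus ;;
  Prepare k a1 ;; Powers ;;
  For rLEN (fun _ => SeqAll ColumnPass hcs ;; Increment) ;;
  Header KV theta.

Lemma fits_Emit K pol j F bad : 12 <= K -> fits K 2 (Emit pol j F bad).
Proof.
move=> HK; have leK i : i <= 12 -> i <= K by move/leq_trans; apply.
have fI : fits K 2 Insert by rewrite /= ?leK.
have fC i : i <= 12 -> fits K 2 (Clear i) by move=> ?; rewrite /= ?leK.
rewrite /Emit !fits_Seq; apply/and3P; split; last first.
- by rewrite fits_CaseB fits_Seq leK //; case: pol; rewrite fI !fC.
- by rewrite /= ?leK.
have H u1 u2 u3 : fits K 1
  ((if bad u1 u2 u3 then Push rFLG true else Skip) ;; PushW rTMP (F u1 u2 u3)).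
  by rewrite fits_Seq fits_PushW ?leK // andbT; case: ifP => //= _; rewrite leK.
by rewrite /Trans fits_For !fits_Seq !fits_PopW ?leK //= ?leK // => *; rewrite !fits_PopW ?leK // => *;
   rewrite !fits_PopW ?leK.
Qed.

Lemma fits_Reduce K : 12 <= K -> fits K 3 Reduce.
Proof.
move=> HK; have leK i : i <= 12 -> i <= K by move/leq_trans; apply.
have fE pol j F bad : fits K 2 (Emit pol j F bad) by apply: fits_Emit.
have fS c1 c2 : fits K 3 c1 -> fits K 3 c2 -> fits K 3 (c1 ;; c2).
  by move=> H1 H2; rewrite fits_Seq H1.
apply: (fS Parse); last apply: (fS (SeqAll _ _)); last apply: (fS (Prepare _ _)); last apply: (fS Powers);
  last apply: fS.
- by rewrite /= ?leK.
- apply: fits_SeqAll => tau.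
  rewrite /ClausePass /ClauseStep fits_Seq fits_For; apply/andP; split.
    by rewrite /= ?leK.
  by rewrite !(fits_Seq, fits_CaseB, fE) /= ?leK.
- have H : fits K 2
      (PushW rY (nseq a1 false) ;; PushW rL3 (nseq a1 true) ;; Push rY1 true).
    by rewrite !fits_Seq !fits_PushW ?leK //= leK.
  have H' : fits K 2 (PopW rLEN k (fun _ =>
      PushW rY (nseq a1 false) ;; PushW rL3 (nseq a1 true) ;; Push rY1 true)).
    by rewrite fits_PopW ?leK.
  by rewrite /Prepare fits_Seq !fits_For; cbv beta; rewrite !fits_Seq H' /= ?leK.
- by rewrite /= ?leK.
- have H : fits K 2 (SeqAll ColumnPass hcs).
    by apply: fits_SeqAll => hc; rewrite fits_Seq fE /= ?leK.
  by rewrite fits_For; cbv beta; rewrite fits_Seq H /= ?leK.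
by rewrite /Header !fits_Seq !fits_For; cbv beta; rewrite !fits_Seq !fits_PushW ?leK //= ?leK.
Qed.

Variable B : nat.

Lemma wp_parse n y Q : n < B -> size y <= B ->
  Q [:: y; nseq n.+1 true; [::]; [::]; [::]; [::]; [::]; [::]; [::]; [::]; [::]; [::]; [::]] ->
  wp B Parse Q [:: nseq n true ++ false :: y; [::]; [::]; [::]; [::]; [::]; [::]; [::]; [::];
                [::]; [::]; [::]; [::]].
Proof.
move=> nB yB HQ; apply: wp_seq.
pose Inv (l : seq nat) s := size l <= n.+1 /\
  s = [:: if l is _ :: l' then nseq (size l') true ++ false :: y else [::];
    nseq (n.+1 - size l) true; [::]; if l is _ :: _ then [::] else rev y; [::]; [::]; [::];
    [::]; [::]; [::]; [::]; [::]; [::]].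
apply: (@wp_for _ _ (iota 0 n.+1) Inv).
- by rewrite size_iota.
- by split; rewrite ?size_iota //= size_iota subnn.
- move=> s [_ ->]; split=> //; apply: wp_move => //; first by st; rewrite size_rev.
  by st; rewrite -[catrev _ _]/(rev _) revK ?subn0.
move=> z [|z' l] s [/= sl ->]; last first.
  exists true, (nseq (size l) true ++ false :: y); split=> //.
  apply: wp_push; st; split; first exact: ltnW.
  by congr [:: _, _ & _]; rewrite -[true :: _]/(nseq _.+1 true); congr nseq => /=; lia.
exists false, y; split=> //; apply: wp_seq; apply: wp_push; st.
apply: wp_move => //; st; split=> //.
by rewrite subSS subn0.
Qed.

Lemma wp_readlit L n w rest y l1 l2 l3 Q out :
  L \in [:: rL1; rL2; rL3] -> n.+1 <= B -> size w = n.+1 ->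
  let s := [:: y; nseq n.+1 true; [::]; [::]; l1; l2; l3; [::]; [::]; [::]; [::];
            w ++ rest; out] in
  reg s L = [::] ->
  Q (upd (upd s rY1 rest) L w) -> wp B (ReadLit L) Q s.
Proof.
move=> HL nB sw s sL HQ; apply: wp_seq.
pose Inv (l : seq bool) s := exists j u, [/\ j + size l = n.+1, u ++ l = w &
  s = [:: y; nseq (size l) true; nseq j true; rev u; l1; l2; l3; [::]; [::]; [::]; [::];
       l ++ rest; out]].
apply: (@wp_for _ _ w Inv).
- by rewrite sw.
- by exists 0, [::]; rewrite /s sw.
- move=> _ [j [u [/= jn uw ->]]]; split=> //.
  rewrite cats0 in uw; rewrite addn0 in jn; rewrite jn uw.
  apply: wp_seq; apply: wp_move; rewrite // /reg ?size_nseq //; st.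
  have {}HQ : Q (upd [:: y; nseq n.+1 true; [::]; [::]; l1; l2; l3; [::]; [::]; [::]; [::];
            rest; out] L w) by [].
  have -> : catrev (nseq n true) [:: true] = nseq n.+1 true.
    by rewrite catrevE rev_nseq -[[:: true]]/(nseq 1 true) -nseqD addn1.
  move: HL sL HQ; rewrite !inE => /or3P[] /eqP -> sL HQ; apply: wp_move => //;
    rewrite /reg /= ?size_rev ?sw //; move: sL HQ; st => ->;
    by rewrite -[catrev _ _]/(rev _) revK.
move=> b l _ [j [u [/= jn uw ->]]]; exists true, (nseq (size l) true); split=> //.
apply: wp_seq; apply: wp_push; st; apply: wp_case_cons => //; apply: wp_push; st.
by exists j.+1, (rcons u b); rewrite cat_rcons rev_rcons; split=> //; lia.
Qed.

Variables (T : eqType) (s1 s2 s3 : T -> bool) (o1 o2 o3 : T -> seq bool) (n m : nat).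
Hypothesis so1 : forall c, size (o1 c) = n.
Hypothesis so2 : forall c, size (o2 c) = n.
Hypothesis so3 : forall c, size (o3 c) = n.
Hypothesis k_gt0 : 0 < k.
Hypothesis a1_gt0 : 0 < a1.
Hypothesis KV_gt0 : 0 < KV.
Hypothesis mk : n.+1 <= m * k < n.+1 + k.
Hypothesis size_F1 : forall tau u1 u2 u3, size (F1 tau u1 u2 u3) = KV.
Hypothesis size_F2 : forall hc u, size (F2 hc u) = KV.

Notation N := (KV * m).

Definition clause_bits (c : T) : seq bool :=
  (s1 c :: o1 c) ++ (s2 c :: o2 c) ++ (s3 c :: o3 c).

Definition word1 (tau : TT) (c : T) : seq bool :=
  flatten (mkseq (fun g => F1 tau (blk k (false :: o1 c) g)
    (blk k (false :: o2 c) g) (blk k (false :: o3 c) g)) m).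

Definition rejected1 (tau : TT) (c : T) : bool :=
  has (fun g => bad1 tau (s1 c) (s2 c) (s3 c) (blk k (false :: o1 c) g)
    (blk k (false :: o2 c) g) (blk k (false :: o3 c) g)) (iota 0 m).

Definition cands1 (cs : seq T) (tau : TT) : seq (seq bool) :=
  flatten [seq if rejected1 tau c then [::] else [:: word1 tau c] | c <- cs].

Definition word2 (z : seq bool) (hc : HT) : seq bool :=
  flatten (mkseq (fun g => F2 hc (blk a1 z g)) m).

Definition accepted2 (z : seq bool) : bool :=
  has (fun g => flag2 (blk a1 z g)) (iota 0 m).

Definition cands2 (z : seq bool) : seq (seq bool) :=
  if accepted2 z then map (word2 z) hcs else [::].

Lemma size_flatten_mkseq (f : nat -> seq bool) :
  (forall g, size (f g) = KV) -> size (flatten (mkseq f m)) = N.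
Proof.
move=> H; rewrite (@size_flatten_all KV) ?size_mkseq // => e.
by case/mapP=> g _ ->.
Qed.

Lemma size_word1 tau c : size (word1 tau c) = N.
Proof. by apply: size_flatten_mkseq => g; rewrite size_F1. Qed.

Lemma size_word2 z hc : size (word2 z hc) = N.
Proof. by apply: size_flatten_mkseq => g; rewrite size_F2. Qed.

Lemma all_size_cands1 cs tau : all_size N (cands1 cs tau).
Proof.
move=> e /flattenP[_ /mapP[c _ ->]]; case: ifP => //= _.
by rewrite inE => /eqP ->; apply: size_word1.
Qed.

Lemma all_size_cands2 z : all_size N (cands2 z).
Proof.
by move=> e; rewrite /cands2; case: ifP => // _ /mapP[hc _ ->]; apply: size_word2.
Qed.

Lemma m_gt0 : 0 < m.
Proof. by case: m mk. Qed.

Lemma N_gt0 : 0 < N.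
Proof. by rewrite muln_gt0 KV_gt0 m_gt0. Qed.

Lemma m_leN : m <= N.
Proof. by rewrite -{1}[m]mul1n leq_mul2r KV_gt0 orbT. Qed.

Lemma wp_clausestep y tau c rest es Q :
  n.+1 <= B -> all_size N es -> N <= B -> N * size es <= B ->
  Q [:: y; nseq n.+1 true; [::]; [::]; [::]; [::]; [::]; [::]; [::]; [::]; [::]; rest;
     flatten (foldl ins es (if rejected1 tau c then [::] else [:: word1 tau c]))] ->
  wp B (ClauseStep k (F1 tau) (bad1 tau)) Q
    [:: y; nseq n.+1 true; [::]; [::]; [::]; [::]; [::]; [::]; [::]; [::]; [::];
        clause_bits c ++ rest; flatten es].
Proof.
move=> nB Nes NB esB HQ; rewrite /clause_bits -!catA.
apply: wp_seq; apply: (@wp_readlit rL1 n (s1 c :: o1 c)) => //; first by rewrite /= so1.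
st; apply: wp_seq; apply: (@wp_readlit rL2 n (s2 c :: o2 c)) => //; first by rewrite /= so2.
st; apply: wp_seq; apply: (@wp_readlit rL3 n (s3 c :: o3 c)) => //; first by rewrite /= so3.
st.
apply: wp_case_cons => //; st; apply: wp_seq; apply: wp_push; st.
apply: wp_case_cons => //; st; apply: wp_seq; apply: wp_push; st.
apply: wp_case_cons => //; st; apply: wp_seq; apply: wp_push; st.
apply: (@wp_emit _ false k _ _ m _ _ _ _ _ _ _ N); rewrite ?N_gt0 ?m_leN //; try by rewrite /= ?so1 ?so2 ?so3.
  exact: size_word1.
by move: HQ; rewrite eqbF_neg if_neg -/(rejected1 tau c); case: ifP.
Qed.

Lemma wp_clausepass y cs tau es Q :
  y = flatten (map clause_bits cs) -> size y <= B ->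
  n.+1 <= B -> all_size N es -> N <= B ->
  N * (size es + size (cands1 cs tau)) <= B ->
  Q [:: y; nseq n.+1 true; [::]; [::]; [::]; [::]; [::]; [::]; [::]; [::]; [::]; [::];
     flatten (foldl ins es (cands1 cs tau))] ->
  wp B (ClausePass k (F1 tau) (bad1 tau)) Q
    [:: y; nseq n.+1 true; [::]; [::]; [::]; [::]; [::]; [::]; [::]; [::]; [::]; [::];
        flatten es].
Proof.
move=> Ey yB nB Nes NB esB HQ; apply: wp_seq; apply: wp_copy => //; st.
have csB : size cs <= B.
  apply: leq_trans yB; rewrite Ey; elim: (cs) => //= c cs' IH.
  by rewrite size_cat /=; lia.
(* The invariant looks forward: inserting the candidates of the remaining clauses into [es'] gives
   the final list. The fuel covers the current list and these candidates together. *)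
pose Inv l s := exists2 es', foldl ins es' (cands1 l tau) = foldl ins es (cands1 cs tau) &
  [/\ all_size N es', N * (size es' + size (cands1 l tau)) <= B &
   s = [:: y; nseq n.+1 true; [::]; [::]; [::]; [::]; [::]; [::]; [::]; [::]; [::];
       flatten (map clause_bits l); flatten es']].
apply: (@wp_for _ _ cs Inv) => //.
- by exists es => //; split=> //; rewrite -Ey.
- by move=> s [es' /= E [_ _ ->]]; split=> //; rewrite E.
move=> c l s [es' E [Nes' es'B ->]].
exists (s1 c), (o1 c ++ (s2 c :: o2 c) ++ (s3 c :: o3 c) ++ flatten (map clause_bits l)).
have Ec r : clause_bits c ++ r = s1 c :: (o1 c ++ (s2 c :: o2 c) ++ (s3 c :: o3 c) ++ r).
  by rewrite /clause_bits /= -!catA /= -!catA.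
split; first exact: Ec.
apply: wp_seq; apply: wp_push; st.
set R := if rejected1 tau c then [::] else [:: word1 tau c].
have cE : cands1 (c :: l) tau = R ++ cands1 l tau by [].
have NR : all_size N R.
  by rewrite /R; case: ifP => // _ e; rewrite inE => /eqP ->; apply: size_word1.
rewrite -Ec.
apply: wp_clausestep => //.
  by apply: leq_trans es'B; rewrite leq_mul2l; lia.
exists (foldl ins es' R); first by rewrite -foldl_cat -cE.
split=> //; first exact: all_size_foldl_ins.
apply: leq_trans es'B; rewrite leq_mul2l cE size_cat.
by have := size_foldl_ins R es'; lia.
Qed.

Lemma wp_clauses y cs Q :
  y = flatten (map clause_bits cs) -> size y <= B -> n.+1 <= B -> N <= B ->
  let L := flatten (map (cands1 cs) taus) in
  N * size L <= B ->
  Q [:: y; nseq n.+1 true; [::]; [::]; [::]; [::]; [::]; [::]; [::]; [::]; [::]; [::];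
     flatten (foldl ins [::] L)] ->
  wp B (SeqAll (fun tau => ClausePass k (F1 tau) (bad1 tau)) taus) Q
    [:: y; nseq n.+1 true; [::]; [::]; [::]; [::]; [::]; [::]; [::]; [::]; [::]; [::];
        [::]].
Proof.
move=> Ey yB nB NB L LB HQ.
pose Inv l s := exists2 es', foldl ins es' (flatten (map (cands1 cs) l)) = foldl ins [::] L &
  [/\ all_size N es', N * (size es' + size (flatten (map (cands1 cs) l))) <= B &
   s = [:: y; nseq n.+1 true; [::]; [::]; [::]; [::]; [::]; [::]; [::]; [::]; [::];
       [::]; flatten es']].
apply: (@wp_mono _ _ (Inv [::])); last first.
  by move=> s [es' /= E [_ _ ->]]; rewrite E.
apply: wp_seqall; last by exists [::].
move=> tau l s [es' E [Nes' es'B ->]].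
apply: (wp_clausepass Ey) => //.
  by apply: leq_trans es'B; rewrite leq_mul2l /= size_cat; lia.
exists (foldl ins es' (cands1 cs tau)); first by rewrite -foldl_cat.
split=> //; first by apply: all_size_foldl_ins => //; apply: all_size_cands1.
apply: leq_trans es'B; rewrite leq_mul2l /= size_cat.
by have := size_foldl_ins (cands1 cs tau) es'; lia.
Qed.

Lemma catrev_nseq (b : bool) i j : catrev (nseq i b) (nseq j b) = nseq (i + j) b.
Proof. by rewrite catrevE rev_nseq -nseqD. Qed.

Lemma wp_prepare y out Q : size y <= B -> m <= B ->
  Q [:: nseq (m * a1) false; [::]; [::]; [::]; [::]; [::]; nseq (m * a1) true; [::]; [::];
     [::]; [::]; nseq m true; out] ->
  wp B (Prepare k a1) Q [:: y; nseq n.+1 true; [::]; [::]; [::]; [::]; [::]; [::]; [::];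
     [::]; [::]; [::]; out].
Proof.
case/andP: mk => mk1 mk2 yB mB HQ; apply: wp_seq; apply: wp_clear => //; st.
pose Inv (l : seq nat) s := exists2 g, g + size l = m &
  s = [:: nseq (g * a1) false; nseq (n.+1 - g * k) true; [::]; [::]; [::]; [::];
     nseq (g * a1) true; [::]; [::]; [::]; [::]; nseq g true; out].
apply: (@wp_for _ _ (iota 0 m) Inv); rewrite ?size_iota //.
- by exists 0; rewrite ?size_iota // mul0n.
- move=> s [g /=]; rewrite addn0 => -> ->.
  by have -> : n.+1 - m * k = 0 by lia.
move=> x l s [g /= gm ->].
have gk : g * k + k <= m * k by rewrite -mulSnr leq_mul2r; lia.
exists true, (nseq (n - g * k) true).
have E : n.+1 - g * k = (n - g * k).+1 by lia.
split; first by st; rewrite E.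
apply: wp_seq; apply: wp_push; st; apply: wp_popW => //; st.
apply: wp_seq; apply: wp_pushW => //; st; apply: wp_seq; apply: wp_pushW => //; st.
apply: wp_push; st; exists g.+1; first by rewrite -gm addSnnS.
rewrite !catrev_nseq -[true :: nseq _ true]/(nseq _.+1 true) -E drop_nseq.
by rewrite -subnDA -mulSnr.
Qed.

Lemma wp_powers l y y1 out Q : 2 ^ l <= B ->
  Q [:: y; nseq (2 ^ l) true; [::]; [::]; [::]; [::]; [::]; [::]; [::]; [::]; [::]; y1; out] ->
  wp B Powers Q [:: y; [::]; [::]; [::]; [::]; [::]; nseq l true; [::]; [::]; [::]; [::];
     y1; out].
Proof.
move=> lB HQ; apply: wp_seq; apply: wp_push; st.
pose Inv (r : seq nat) s := exists2 g, g + size r = l &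
  s = [:: y; nseq (2 ^ g) true; [::]; [::]; [::]; [::]; nseq (size r) true; [::]; [::];
       [::]; [::]; y1; out].
apply: (@wp_for _ _ (iota 0 l) Inv).
- by rewrite size_iota; apply: leq_trans lB; apply/ltnW/ltn_expl.
- by exists 0; rewrite size_iota // expn0.
- by move=> s [g /=]; rewrite addn0 => -> ->.
move=> x r s [g /= gl ->]; exists true, (nseq (size r) true); split=> //.
have gB : 2 ^ g.+1 <= B by apply: leq_trans lB; rewrite leq_exp2l //; lia.
apply: wp_seq; st.
pose Inv2 (q : seq nat) s := exists2 h, h + size q = 2 ^ g &
  s = [:: y; nseq (size q) true; nseq h.*2 true; [::]; [::]; [::]; nseq (size r) true;
       [::]; [::]; [::]; [::]; y1; out].
apply: (@wp_for _ _ (iota 0 (2 ^ g)) Inv2).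
- by rewrite size_iota; apply: leq_trans gB; rewrite leq_exp2l.
- by exists 0; rewrite size_iota.
- move=> s' [h /=]; rewrite addn0 => -> ->; split=> //.
  rewrite -mul2n -expnS; apply: wp_move => //; first by rewrite /reg /= size_nseq.
  st; exists g.+1; first by lia.
  by rewrite (catrev_nseq true _ 0) addn0.
move=> z q _ [h /= hg ->]; exists true, (nseq (size q) true); split=> //.
apply: wp_seq; apply: wp_push; st; apply: wp_push; st.
by exists h.+1; [lia|].
Qed.

Lemma wp_increment w y1 x out Q : size w < B ->
  Q [:: incr w; x; [::]; [::]; [::]; [::]; [::]; [::]; [::]; [::]; [::]; y1; out] ->
  wp B Increment Q [:: w; x; [::]; [::]; [::]; [::]; [::]; [::]; [::]; [::]; [::]; y1; out].
Proof.
move=> wB HQ; apply: wp_seq; apply: wp_push; st; apply: wp_seq.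
pose Inv (r : seq bool) s := exists v (c : bool), 
  catrev v (if c then incr r else r) = incr w /\
  s = [:: r; x; [::]; v; [::]; [::]; [::]; nseq c true; [::]; [::]; [::]; y1; out].
apply: (@wp_for _ _ w Inv); first exact: ltnW.
- by exists [::], true.
- move=> _ [v [c [E ->]]]; split=> //; apply: wp_seq; apply: wp_clear => //.
    by st; rewrite size_nseq; case: c {E}; lia.
  have {}E : catrev v [::] = incr w by move: E; case: c.
  st; apply: wp_move => //; st; last by rewrite E.
  by rewrite -(size_rev v) -[rev v]/(catrev v [::]) E size_incr; apply: ltnW.
move=> b r _ [v [c [E ->]]]; exists b, r; split=> //.
case: c E => E.
  apply: wp_case_cons => //; st; case: b E => /= E.
    by apply: wp_seq; apply: wp_push; st; apply: wp_push; st; exists (false :: v), true.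
  by apply: wp_push; st; exists (true :: v), false.
by apply: wp_case_nil => //; apply: wp_push; st; exists (b :: v), false.
Qed.

Lemma wp_header y y1 out Q : size y <= B -> m <= B ->
  Q [:: [::]; nseq (theta * m) true; [::]; [::]; [::]; [::]; [::]; [::]; [::]; [::]; [::];
     [::]; nseq N true ++ false :: out] ->
  y1 = nseq m true ->
  wp B (Header KV theta) Q
    [:: y; [::]; [::]; [::]; [::]; [::]; [::]; [::]; [::]; [::]; [::]; y1; out].
Proof.
move=> yB mB HQ ->; apply: wp_seq; apply: wp_clear => //; st.
apply: wp_seq; apply: wp_push; st.
pose Inv (r : seq nat) s := exists2 g, g + size r = m &
  s = [:: [::]; nseq (theta * g) true; [::]; [::]; [::]; [::]; [::]; [::]; [::]; [::]; [::];
     nseq (size r) true; nseq (KV * g) true ++ false :: out].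
apply: (@wp_for _ _ (iota 0 m) Inv); rewrite ?size_iota //.
- by exists 0; rewrite ?size_iota // !muln0.
- by move=> s [g /=]; rewrite addn0 => -> ->.
move=> x r _ [g /= gm ->]; exists true, (nseq (size r) true); split=> //; st.
apply: wp_seq; apply: wp_pushW => //; st; apply: wp_pushW => //; st.
exists g.+1; first by lia.
by rewrite catrev_nseq !mulnS catrevE rev_nseq catA -nseqD.
Qed.

Lemma wp_columns z y1 es x Q : size z = m * a1 -> size z <= B ->
  all_size N es -> N <= B -> N * (size es + size (cands2 z)) <= B ->
  Q [:: z; x; [::]; [::]; [::]; [::]; [::]; [::]; [::]; [::]; [::]; y1;
     flatten (foldl ins es (cands2 z))] ->
  wp B (SeqAll ColumnPass hcs) Q
    [:: z; x; [::]; [::]; [::]; [::]; [::]; [::]; [::]; [::]; [::]; y1; flatten es].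
Proof.
move=> sz zB Nes NB esB HQ.
pose C (l : seq HT) := if accepted2 z then map (word2 z) l else [::].
pose Inv l s := exists2 es', foldl ins es' (C l) = foldl ins es (C hcs) &
  [/\ all_size N es', N * (size es' + size (C l)) <= B &
   s = [:: z; x; [::]; [::]; [::]; [::]; [::]; [::]; [::]; [::]; [::]; y1; flatten es']].
apply: (@wp_mono _ _ (Inv [::])); last first.
  move=> s [es' E [_ _ ->]]; move: HQ.
  by rewrite -[cands2 z]/(C hcs) -E /C /= if_same.
apply: wp_seqall; last by exists es.
move=> hc l s [es' E [Nes' es'B ->]].
apply: wp_seq; apply: wp_copy => //; st.
have sC : size (C l) <= size (C (hc :: l)) by rewrite /C; case: ifP => //=.
apply: (@wp_emit _ true a1 _ _ m _ _ _ _ _ _ _ N); rewrite ?N_gt0 ?m_leN //.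
- by rewrite sz leqnn /= -[X in X < _]addn0 ltn_add2l.
- exact: size_word2.
- by apply: leq_trans es'B; rewrite leq_mul2l; lia.
rewrite eqb_id -/(accepted2 z) -/(word2 z hc); move: E es'B {sC}.
rewrite /Inv /C; case: (accepted2 z) => E es'B; last by exists es'.
exists (ins es' (word2 z hc)) => //; split=> //.
  apply: (@all_size_foldl_ins _ [:: word2 z hc]) => // e.
  by rewrite inE => /eqP ->; apply: size_word2.
apply: leq_trans es'B; rewrite leq_mul2l /=.
by have := size_foldl_ins [:: word2 z hc] es' => /=; lia.
Qed.

Definition cands (cs : seq T) : seq (seq bool) :=
  flatten (map (cands1 cs) taus) ++
  flatten (map cands2 (traject incr (nseq (m * a1) false) (2 ^ (m * a1)))).

Lemma all_size_cands cs : all_size N (cands cs).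
Proof.
move=> e; rewrite mem_cat => /orP[] /flattenP[_ /mapP[x _ ->]].
  exact: all_size_cands1.
exact: all_size_cands2.
Qed.

Lemma wp_reduce cs : let y := flatten (map clause_bits cs) in
  size y <= B -> n < B -> m * a1 < B -> 2 ^ (m * a1) <= B -> N <= B ->
  N * size (cands cs) <= B ->
  wp B Reduce (fun s => s = [:: [::]; nseq (theta * m) true; [::]; [::]; [::]; [::]; [::];
     [::]; [::]; [::]; [::]; [::];
     nseq N true ++ false :: flatten (foldl ins [::] (cands cs))])
   [:: nseq n true ++ false :: y; [::]; [::]; [::]; [::]; [::]; [::]; [::]; [::]; [::]; [::];
     [::]; [::]].
Proof.
move=> y yB nB lB pB NB cB; set L := m * a1 in lB pB.
have mB : m <= B by apply: leq_trans m_leN NB.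
apply: wp_seq; apply: wp_parse => //; apply: wp_seq; apply: wp_clauses => //.
  by apply: leq_trans cB; rewrite leq_mul2l /cands size_cat leq_addr orbT.
apply: wp_seq; apply: wp_prepare => //; apply: wp_seq; apply: wp_powers => //.
apply: wp_seq.
set es0 := foldl ins [::] (flatten (map (cands1 cs) taus)).
(* The candidates still to be generated when the counter is [z] and [size r] rounds remain. *)
pose D (r : seq nat) z := flatten (map cands2 (traject incr z (size r))).
pose Inv (r : seq nat) s := exists z es, [/\ size z = L, all_size N es,
  foldl ins es (D r z) = foldl ins [::] (cands cs), N * (size es + size (D r z)) <= B &
  s = [:: z; nseq (size r) true; [::]; [::]; [::]; [::]; [::]; [::]; [::]; [::]; [::];
       nseq m true; flatten es]].
apply: (@wp_for _ _ (iota 0 (2 ^ L)) Inv); rewrite ?size_iota //.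
- exists (nseq L false), es0; rewrite /D !size_iota size_nseq; split=> //.
  + apply: all_size_foldl_ins; first by [].
    move=> e /flattenP[_ /mapP[tau _ ->]]; exact: all_size_cands1.
  + by rewrite /cands foldl_cat.
  apply: leq_trans cB; rewrite leq_mul2l /cands size_cat -/L leq_add2r.
  by have := size_foldl_ins (flatten (map (cands1 cs) taus)) [::]; rewrite -/es0 /=; lia.
- move=> s [z [es [sz Nes E _ ->]]]; split=> //.
  apply: wp_header; rewrite /= ?sz //; first exact: ltnW.
  by move: E => /= ->.
move=> x r s [z [es [sz Nes E esB ->]]].
exists true, (nseq (size r) true); split=> //; st; apply: wp_seq.
have DE : D (x :: r) z = cands2 z ++ D r (incr z) by [].
rewrite DE size_cat in esB.
apply: wp_columns => //; rewrite ?sz //; first exact: ltnW.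
  by apply: leq_trans esB; rewrite leq_mul2l; lia.
apply: wp_increment; rewrite ?sz //.
exists (incr z), (foldl ins es (cands2 z)); rewrite size_incr; split=> //.
- by apply: all_size_foldl_ins => //; apply: all_size_cands2.
- by rewrite -foldl_cat -DE.
apply: leq_trans esB; rewrite leq_mul2l.
by have := size_foldl_ins (cands2 z) es; lia.
Qed.

End Reduction.

(** * The program of the decision *)

(* Whether register [rOUT] contains more bits [true] than register [rLEN]. *)
Definition Decide : cmd :=
  For rOUT (fun b => if b then CaseB rLEN (Push rFLG true) (fun _ => Skip) else Skip) ;;
  CaseB rFLG (Push rY false) (fun _ => Push rY true).

Lemma fits_Decide K : 12 <= K -> fits K 1 Decide.
Proof.
move=> HK; have leK i : i <= 12 -> i <= K by move/leq_trans; apply.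
by rewrite /= ?leK.
Qed.

Lemma wp_decide B (w : seq bool) (t : nat) (junk : store) : size w <= B ->
  wp B Decide (fun s => reg s rY = [:: t < count id w])
    [:: [::], nseq t true, [::], [::], [::], [::], [::], [::], [::], [::], [::], [::], w & junk].
Proof.
move=> wB; apply: wp_seq.
pose Inv (r : seq bool) s := exists u t' flg, [/\ u ++ r = w, 
  t' = t - count id u, (flg != [::]) = (t < count id u) &
  s = [:: [::], nseq t' true, [::], [::], [::], [::], [::], flg, [::], [::], [::], [::], r & junk]].
apply: (@wp_for _ _ w Inv) => //.
- by exists [::], t, [::]; rewrite subn0.
- move=> s [u [t' [flg [E1 _ E2 ->]]]]; split=> //.
  rewrite cats0 in E1; rewrite E1 in E2; rewrite -E2.
  by case: flg E2 => [|f flg] _; [apply: wp_case_nil|apply: wp_case_cons].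
move=> b r s [u [t' [flg [E1 Et E2 ->]]]]; exists b, r; split=> //; st.
have cu : count id (rcons u b) = count id u + b by rewrite -cats1 count_cat /= addn0.
case: b cu E1 => cu E1; last first.
  rewrite /wp /=; exists (rcons u false), t', flg; rewrite cat_rcons cu addn0.
  by split.
case: t' Et => [|t'] Et.
  apply: wp_case_nil => //; apply: wp_push; st.
  exists (rcons u true), 0, (true :: flg); rewrite cat_rcons cu.
  by split=> //=; lia.
apply: wp_case_cons => //; rewrite /wp /=; st.
exists (rcons u true), t', flg; rewrite cat_rcons cu.
by split=> //; [lia|rewrite E2; lia].
Qed.

(** * The hypergraph of a formula *)

(** Overwriting the value at [x] by an arbitrary [y] is injective on the functions that agree at [x]
    and [x']: the lost value can be read at [x']. *)
Lemma card_agree (X Y : finType) (x x' : X) : x != x' ->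
  #|[set h : {ffun X -> Y} | h x == h x']| * #|Y| <= #|{ffun X -> Y}|.
Proof.
move=> xx'; rewrite -[X in _ * X]cardsT -cardsX -[X in _ <= X]cardsT.
pose f (p : {ffun X -> Y} * Y) : {ffun X -> Y} := [ffun z => if z == x then p.2 else p.1 z].
rewrite -(@card_in_imset _ _ f); first exact: subset_leq_card (subsetT _).
move=> [h y] [h' y'] /setXP[/= + _] /setXP[/= + _]; rewrite !inE => /eqP hx /eqP hx' /ffunP E.
have Ey : y = y' by have := E x; rewrite !ffunE eqxx.
suff Eh : h = h' by rewrite Ey Eh.
have E' z : z != x -> h z = h' z by move=> /negPf zx; have := E z; rewrite !ffunE zx.
apply/ffunP=> z; have [->|/E'] := eqVneq z x; last by [].
by rewrite hx hx' E' // eq_sym.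
Qed.

(** The private hyperedge of [w] is one that [F :\ w] fails to hit. *)
Lemma minimal_hitting_setP (n : nat) (E : {set {set 'I_n}}) (F : {set 'I_n}) w :
  minimal_hitting_set E F -> w \in F ->
  exists2 e, e \in E & w \in e /\ forall x, x \in e -> x != w -> x \notin F.
Proof.
case/minsetP=> hF minF wF.
have /forall_inPn[e eE] : ~~ hitting_set E (F :\ w).
  apply/negP=> h; have := minF _ h (subD1set _ _) => /setP/(_ w).
  by rewrite wF !inE eqxx.
rewrite negbK => /eqP e0; exists e => //.
have H x : x \in e -> x != w -> x \notin F.
  move=> xe xw; apply/negP=> xF; have /setP/(_ x) := e0.
  by rewrite !inE xw xF xe.
split=> //; have /forall_inP/(_ _ eE)/set0Pn[x /setIP[xF xe]] := hF.
by have [<- //|/(H _ xe)] := eqVneq x w; rewrite xF.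
Qed.

Section Hypergraph.
Variables (k a m n : nat) (phi : {set clause n}).
Hypothesis k_gt0 : 0 < k.
Hypothesis mk : n.+1 <= m * k.

Notation aT := (a.-tuple bool).
Notation kT := (k.-tuple bool).
Definition position := {ffun kT -> aT}.

(* The vertices of one group of [k] variables. The vertex [inl (h, v)] stays out of
   the hitting set when the hash [h] of the values of the variables is [v]; the
   vertices [inr (h, c)] can belong to the hitting set only when every group has a
   hash at position [h]. *)
Definition vertex := ((position * aT) + (position * (aT * aT)))%type.
Definition gsize := #|{: vertex}|.

Lemma vx_lt (g : 'I_m) (u : vertex) : g * gsize + enum_rank u < gsize * m.
Proof.
rewrite mulnC; apply: (@leq_trans (gsize * g.+1)); last by rewrite leq_mul2l ltn_ord orbT.
by rewrite mulnS addnC ltn_add2r.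
Qed.

Definition vx (g : 'I_m) (u : vertex) : 'I_(gsize * m) := Ordinal (vx_lt g u).

Lemma grp_lt (i : 'I_n) : i.+1 %/ k < m.
Proof. by rewrite ltn_divLR //; apply: leq_trans mk; rewrite ltnS. Qed.

(* The variable [i] is at place [i + 1], and place [0] is not used. *)
Definition grp (i : 'I_n) : 'I_m := Ordinal (grp_lt i).
Definition slot (i : 'I_n) : nat := i.+1 %% k.

Definition sec (e : {set 'I_(gsize * m)}) (g : 'I_m) : {set vertex} :=
  [set u | vx g u \in e].

Definition consistent (al : kT) (S : {set vertex}) : bool :=
  [forall h : position, forall v : aT, (inl (h, v) \in S) ==> (h al == v)].

(** Once all of [S] is outside the hitting set, no assignment that fits these hashes makes the
    literal true. This includes sets [S] that fit no assignment at all. *)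
Definition refutes (S : {set vertex}) (j : nat) (b : bool) : bool :=
  [forall al : kT, consistent al S ==> (nth false al j != b)].

Definition pure (S : {set vertex}) : bool := [forall p, inr p \notin S].

(** Each literal has its own refuting set; literals whose variables share a group contribute to the
    same section by union. *)
Definition clause_edge (e : {set 'I_(gsize * m)}) : Prop :=
  exists (C : clause n) (S : 'I_3 -> {set vertex}),
  [/\ C \in phi,
      forall t, pure (S t) && refutes (S t) (slot (tnth C t).1) (tnth C t).2 &
      forall g, sec e g = \bigcup_(t | grp (tnth C t).1 == g) S t].

(** One hash value per group at the common position [h], and the column vertex [(h, c)] in each
    flagged group. If this is the private hyperedge of a column vertex, every group has a hash at
    [h]. *)
Definition column_edge (e : {set 'I_(gsize * m)}) : Prop :=
  exists (h : position) (c : aT * aT) (v : 'I_m -> aT) (f : 'I_m -> bool),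
  (exists g, f g) /\
  forall g, sec e g = inl (h, v g) |: (if f g then [set inr (h, c)] else set0).

Variable E : {set {set 'I_(gsize * m)}}.
Hypothesis EP : forall e, e \in E <-> clause_edge e \/ column_edge e.

Lemma vxK (i : 'I_(gsize * m)) : exists g u, i = vx g u.
Proof.
have g0 : 0 < gsize by case: gsize i => // -[].
have gm : i %/ gsize < m by rewrite ltn_divLR // [X in _ < X]mulnC.
have gr : i %% gsize < #|{: vertex}| by rewrite ltn_mod.
exists (Ordinal gm), (enum_val (Ordinal gr)); apply/val_inj => /=.
by rewrite enum_valK /= -divn_eq.
Qed.

Lemma vx_inj g g' u u' : vx g u = vx g' u' -> g = g' /\ u = u'.
Proof.
move/(congr1 val) => /= Eq.
have g0 : 0 < gsize by rewrite /gsize; apply: leq_ltn_trans (ltn_ord (enum_rank u)).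
have : (g * gsize + enum_rank u) %/ gsize = (g' * gsize + enum_rank u') %/ gsize by rewrite Eq.
rewrite !divnMDl // !divn_small ?ltn_ord // !addn0 => /val_inj gg.
split=> //; apply/enum_rank_inj/val_inj/eqP; rewrite -(eqn_add2l (g * gsize)) /=.
by rewrite Eq gg.
Qed.

Lemma consistent_clause al S j b : consistent al S -> refutes S j b -> nth false al j != b.
Proof. by move=> c /forallP/(_ al)/implyP; apply. Qed.

(** The empty set refutes no literal, because the constant assignment with the value of the literal
    is consistent with it. Column edges contain a hash in every group. *)
Lemma set0_notin_E : set0 \notin E.
Proof.
have s0 g : sec set0 g = set0 by apply/setP=> u; rewrite !inE.
apply/negP=> /EP[[C [S [_ HS Hs]]]|[h [c [v [f [[g _] Hs]]]]]]; last first.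
  by have /setP/(_ (inl (h, v g))) := Hs g; rewrite s0 !inE eqxx.
have /andP[_ /forallP R] := HS ord0.
pose al : kT := [tuple of nseq k (tnth C ord0).2].
have /implyP := R al; rewrite nth_nseq ltn_mod k_gt0 eqxx => /(_ _)/negP; apply=> //.
apply/forallP=> h; apply/forallP=> v; apply/implyP=> Sv.
have /setP/(_ (inl (h, v))) := Hs (grp (tnth C ord0).1); rewrite s0 !inE.
by move/esym/negbT/bigcupP; case; exists ord0.
Qed.

(** Let [I] consist of the hashes of a satisfying assignment. The complement of [I] is a hitting
    set, and every minimal hitting set inside it contains all column vertices, which gives the
    count. *)
Lemma satisfiable_opt :
  satisfiable phi -> #|position| * (2 ^ a * 2 ^ a) * m <= max_min_hitting_set E.
Proof.
case/existsP=> x /forall_inP Hx.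
(* The assignment [x] cut into groups; places that carry no variable get [false]. *)
pose al (g : 'I_m) : kT := [tuple [exists i, (grp i == g) && (slot i == j) && x i] | j < k].
have alE i : nth false (al (grp i)) (slot i) = x i.
  have sk : slot i < k by rewrite ltn_mod.
  rewrite -[slot i]/(nat_of_ord (Ordinal sk)) -tnth_nth tnth_mktuple.
  apply/existsP/idP => [[i' /andP[/andP[/eqP gi /eqP si]]]|xi]; last by exists i; rewrite !eqxx.
  suff -> : i = i' by [].
  apply/val_inj => /=; move: (congr1 val gi) si => /= gi' si'.
  by have := divn_eq i.+1 k; rewrite -gi' -[i.+1 %% k]si' -divn_eq => -[].
pose I : {set 'I_(gsize * m)} := [set i | [exists g, exists h : position,
  i == vx g (inl (h, h (al g)))]].
have IE g h v : (vx g (inl (h, v)) \in I) = (h (al g) == v).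
  rewrite inE; apply/existsP/eqP => [[g' /existsP[h' /eqP/vx_inj[-> [-> ->]]]] //|<-].
  by exists g; apply/existsP; exists h.
have IE' g p : vx g (inr p) \notin I.
  by rewrite inE; apply/existsP=> -[g' /existsP[h' /eqP/vx_inj[]]].
have hI : hitting_set E (~: I).
  (* A clause edge inside [I] would refute a true literal, and a column edge contains a vertex
     [inr], none of which is in [I]. *)
  apply/forall_inP=> e /EP eE; apply/negP=> /eqP e0.
  have eI i : i \in e -> i \in I.
    by move=> ie; have /setP/(_ i) := e0; rewrite !inE ie andbT => /negbT; rewrite negbK.
  case: eE => [[C [S [CP HS Hs]]]|[h [c [v [f [[g fg] Hs]]]]]]; last first.
    have : vx g (inr (h, c)) \in e.
      by have /setP/(_ (inr (h, c))) := Hs g; rewrite fg !inE eqxx orbT => ->.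
    by move/eI; rewrite (negPf (IE' _ _)).
  have /hasP[l /tnthP[t El] /eqP xl] := Hx _ CP.
  have /andP[_ R] := HS t; rewrite -El in R.
  have /consistent_clause/(_ R) : consistent (al (grp l.1)) (S t).
    apply/forallP=> h; apply/forallP=> v; apply/implyP=> Sv; rewrite -IE; apply: eI.
    have /setP/(_ (inl (h, v))) := Hs (grp l.1); rewrite inE => ->.
    by apply/bigcupP; exists t; rewrite -?El.
  by rewrite alE xl eqxx.
have [F mF FI] := minset_exists hI.
apply: leq_trans (leq_bigmax_cond (F := fun F : {set _} => #|F|) _ mF).
pose W : {set 'I_m * (position * (aT * aT))} := setT.
have <- : #|[set vx p.1 (inr p.2) | p in W]| = #|position| * (2 ^ a * 2 ^ a) * m.
  rewrite card_imset; first by rewrite cardsT !card_prod card_ord !card_tuple card_bool mulnC.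
  by move=> [g p] [g' p'] /vx_inj[/= -> [->]].
apply/subset_leq_card/subsetP=> _ /imsetP[[g [h c]] _ ->] /=.
(* This hyperedge leaves [I] only at the chosen column vertex, so [F], which avoids [I], must
   contain that vertex. *)
pose col : {set 'I_(gsize * m)} := vx g (inr (h, c)) |: [set vx g' (inl (h, h (al g'))) | g' : 'I_m].
have colE : col \in E.
  apply/EP; right; exists h, c, (fun g => h (al g)), (pred1 g); split.
    by exists g => /=.
  move=> g'; apply/setP=> u; rewrite !inE /=.
  have -> : (vx g' u == vx g (inr (h, c))) = (g' == g) && (u == inr (h, c)).
    by apply/eqP/andP => [/vx_inj[-> ->]|[/eqP -> /eqP ->]].
  have -> : (vx g' u \in [set vx g' (inl (h, h (al g'))) | g' : 'I_m]) = (u == inl (h, h (al g'))).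
    apply/imsetP/eqP => [[g'' _ /vx_inj[-> ->]] //|->]; by exists g'.
  by case: (g' == g); rewrite !inE // orbC.
have /minsetP[/forall_inP/(_ _ colE)/set0Pn[i /setIP[iF + ]] _] := mF.
rewrite !inE => /orP[/eqP <- //|/imsetP[g' _ Ei]].
by have /subsetP/(_ _ iF) := FI; rewrite Ei inE IE eqxx.
Qed.

(** Let [P] be the set of positions with a column vertex in [F]. Private hyperedges give every group
    a hash outside [F] at each position of [P]. The size of [F] forces [|P|] above the fraction
    [1 / A] of all positions, so by [card_agree] each group has at most one consistent
    assignment. *)
Lemma opt_satisfiable F : minimal_hitting_set E F ->
  2 * (#|position| * 2 ^ a) * m < #|F| -> satisfiable phi.
Proof.
move=> mF ltF.
pose P : {set position} := [set h | [exists g, exists c, vx g (inr (h, c)) \in F]].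
have P_col h g : h \in P -> exists v, vx g (inl (h, v)) \notin F.
  rewrite inE => /existsP[g0 /existsP[c wF]].
  have [e /EP eE [we eF]] := minimal_hitting_setP mF wF.
  case: eE => [[C [S [_ HS Hs]]]|[h' [c' [v [f [_ Hs]]]]]].
    have : inr (h, c) \in sec e g0 by rewrite inE.
    rewrite Hs => /bigcupP[t _]; have /andP[/forallP/(_ (h, c))] := HS t.
    by move=> /negPf ->.
  have hh : h' = h.
    have : inr (h, c) \in sec e g0 by rewrite inE.
    by rewrite Hs !inE; case: (f g0); rewrite inE // => /eqP[].
  exists (v g); apply: eF; last by apply/eqP=> /vx_inj[].
  by have : inl (h', v g) \in sec e g; [rewrite Hs !inE eqxx|rewrite inE hh].
(* Otherwise each group meets [F] in at most [|position| A] hash vertices and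
   [|P| A ^ 2 <= |position| A] column vertices, with [A = 2 ^ a]. *)
have cP : #|position| < #|P| * 2 ^ a.
  rewrite ltnNge; apply/negP=> leP; move: ltF; apply/negP; rewrite -leqNgt.
  pose U : {set vertex} := [set inl p | p in [set: position * aT]] :|:
     [set inr p | p in setX P [set: aT * aT]].
  have cU : #|U| <= 2 * (#|position| * 2 ^ a).
    have : #|U| <= #|position| * 2 ^ a + #|P| * (2 ^ a * 2 ^ a).
      apply: leq_trans (leq_card_setU _ _).1 _; apply: leq_add.
        by apply: leq_trans (leq_imset_card _ _) _; rewrite cardsT card_prod card_tuple card_bool.
      apply: leq_trans (leq_imset_card _ _) _.
      by rewrite cardsX cardsT card_prod card_tuple card_bool.
    move: leP; move: (#|P|) (2 ^ a) (#|position|) => p b q leP H.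
    apply: leq_trans H _; rewrite mul2n -addnn leq_add2l mulnA.
    by rewrite leq_mul2r leP orbT.
  apply: leq_trans (_ : #|setX [set: 'I_m] U| <= _); last first.
    by rewrite cardsX cardsT card_ord mulnC leq_mul2r cU orbT.
  apply: leq_trans (leq_imset_card (fun p => vx p.1 p.2) _).
  apply/subset_leq_card/subsetP=> i; have [g [u ->]] := vxK i => uF.
  apply/imsetP; exists (g, u) => //; rewrite !inE /=.
  case: u uF => [p|[h c]] uF; first by rewrite imset_f.
  apply/orP; right; apply: imset_f; rewrite !inE /= andbT.
  by apply/existsP; exists g; apply/existsP; exists c.
pose I g : {set vertex} := [set u | (vx g u \notin F) && (if u is inl _ then true else false)].
(* Two consistent assignments have the same hash at all positions of [P], too many for distinct
   ones. *)
have uniq_al g al al' : consistent al (I g) -> consistent al' (I g) -> al = al'.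
  move=> /forallP c1 /forallP c2; apply/eqP; apply: contraLR cP => neq; rewrite -leqNgt.
  have := card_agree aT neq; rewrite card_tuple card_bool; apply: leq_trans.
  rewrite leq_mul2r; apply/orP; right; apply/subset_leq_card/subsetP=> h hP.
  have [v hv] := P_col h g hP; rewrite inE.
  have /forallP/(_ v)/implyP := c1 h; rewrite inE hv => /(_ isT)/eqP ->.
  by have /forallP/(_ v)/implyP := c2 h; rewrite inE hv => /(_ isT)/eqP ->.
(* The default is harmless: when no assignment is consistent, [I g] refutes every literal
   vacuously. *)
pose al g : kT := odflt [tuple of nseq k false] [pick al | consistent al (I g)].
pose x : {ffun 'I_n -> bool} := [ffun i => nth false (al (grp i)) (slot i)].
apply/existsP; exists x; apply/forall_inP=> C CP; apply/negPn/negP=> /hasPn HC.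
have R t : refutes (I (grp (tnth C t).1)) (slot (tnth C t).1) (tnth C t).2.
  apply/forallP=> al'; apply/implyP=> c'.
  have := HC _ (mem_tnth t C); rewrite ffunE /al.
  case: pickP => [al0 c0|/(_ al')]; last by rewrite c'.
  by rewrite (uniq_al _ _ _ c' c0).
(* All hashes outside [F] in the groups of a falsified clause form a clause edge that [F] misses, a
   contradiction. *)
pose S t := I (grp (tnth C t).1).
pose e : {set 'I_(gsize * m)} := \bigcup_t [set vx (grp (tnth C t).1) u | u in S t].
have eE : e \in E.
  apply/EP; left; exists C, S; split=> // [t|g].
    by rewrite R andbT; apply/forallP=> p; rewrite inE andbF.
  apply/setP=> u; rewrite inE; apply/bigcupP/bigcupP => [[t _ /imsetP[u' uS /vx_inj[-> ->]]]|].
    by exists t.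
  by case=> t /eqP <- uS; exists t => //; apply: imset_f.
have /minsetP[/forall_inP/(_ _ eE)/set0Pn[i /setIP[iF + ]] _] := mF.
by case/bigcupP=> t _ /imsetP[u]; rewrite inE => /andP[uF _] Ei; rewrite -Ei iF in uF.
Qed.

End Hypergraph.

(** * The program computes the hypergraph *)

Lemma nth_flatten_block (T : Type) (x0 : T) j (L : seq (seq T)) g i :
  all (fun u => size u == j) L -> i < j ->
  nth x0 (flatten L) (g * j + i) = nth x0 (nth [::] L g) i.
Proof.
move=> + ij; elim: L g => [|u L IH] g /=; first by rewrite !nth_nil.
case/andP=> /eqP su sL; rewrite nth_cat su; case: g => [|g] /=; first by rewrite ij.
by rewrite mulSn -addnA ltnNge leq_addr /= addKn IH.
Qed.

Lemma blk_flatten j (L : seq (seq bool)) g : all (fun u => size u == j) L -> g < size L ->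
  blk j (flatten L) g = nth [::] L g.
Proof.
move=> sL gL; have /eqP su : size (nth [::] L g) == j by apply: (all_nthP _ sL).
apply: (@eq_from_nth _ false); first by rewrite size_mkseq.
move=> i; rewrite size_mkseq => ij; rewrite nth_mkseq //.
exact: nth_flatten_block.
Qed.

Definition onehot (n : nat) (i : 'I_n) : seq bool := [seq j == i | j <- enum 'I_n].

Lemma size_onehot n (i : 'I_n) : size (onehot i) = n.
Proof. by rewrite size_map size_enum_ord. Qed.

Lemma nth_onehot n (i : 'I_n) p : nth false (false :: onehot i) p = (p == i.+1).
Proof.
case: p => //= p; rewrite eqSS; have [pn|np] := ltnP p n; last first.
  by rewrite nth_default ?size_onehot //; apply/esym/negbTE; rewrite neq_ltn (leq_trans _ np) ?orbT.
by rewrite (nth_map i) ?size_enum_ord // -val_eqE /= nth_enum_ord.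
Qed.

(** The single bit [true] is at place [i + 1]; division by [k] gives its block as the quotient and
    its index there as the remainder. *)
Lemma blk_onehot k n (i : 'I_n) g : 0 < k ->
  (true \in blk k (false :: onehot i) g) = (i.+1 %/ k == g) /\
  (i.+1 %/ k == g -> index true (blk k (false :: onehot i) g) = i.+1 %% k).
Proof.
move=> k0; set w := blk _ _ _.
have sw : size w = k by rewrite size_mkseq.
have wE j : j < k -> nth false w j = (g * k + j == i.+1).
  by move=> jk; rewrite nth_mkseq // nth_onehot.
have H j : j < k -> nth false w j = (i.+1 %/ k == g) && (j == i.+1 %% k).
  move=> jk; rewrite wE //; apply/eqP/andP => [<-|[/eqP <- /eqP ->]]; last by rewrite -divn_eq.
  by rewrite divnMDl // divn_small // addn0 modnMDl modn_small // !eqxx.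
have ik : i.+1 %% k < k by rewrite ltn_mod.
split.
  apply/idP/idP => [/(nthP false)[j]|gE]; rewrite ?sw.
    by move=> jk; rewrite H // => /andP[].
  by apply/(nthP false); exists (i.+1 %% k); rewrite ?sw // H // gE eqxx.
move=> gE; have tw : true \in w.
  by apply/(nthP false); exists (i.+1 %% k); rewrite ?sw // H // gE eqxx.
have := nth_index false tw; rewrite H -?sw ?index_mem // => /andP[_ /eqP].
by [].
Qed.

Section Link.
Variables (k a m n : nat) (phi : {set clause n}) (cs : seq (clause n)).
Hypothesis k_gt0 : 0 < k.
Hypothesis mk : n.+1 <= m * k < n.+1 + k.
Hypothesis csP : perm_eq cs (enum phi).

Notation V := (vertex k a).
Notation K := (gsize k a).
Notation N := (K * m).

Let mk1 : n.+1 <= m * k. Proof. by case/andP: mk. Qed.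

Definition chunk (S : {set V}) : seq bool := [seq u \in S | u <- enum {: V}].

Lemma size_chunk S : size (chunk S) = K.
Proof. by rewrite size_map -cardE. Qed.

(** Purity does not depend on the clause and is checked here; whether the sets refute its literals
    is tested by the program through [clause_missed]. *)
Definition triples : seq ({set V} * {set V} * {set V}) :=
  [seq p <- enum {: {set V} * {set V} * {set V}} | [&& pure p.1.1, pure p.1.2 & pure p.2]].

Definition columns : seq (position k a * (a.-tuple bool * a.-tuple bool)) :=
  enum {: position k a * (a.-tuple bool * a.-tuple bool)}.

Definition hit (S : {set V}) (u : seq bool) : {set V} := if true \in u then S else set0.

Definition missed (S : {set V}) (b : bool) (u : seq bool) : bool :=
  (true \in u) && ~~ refutes S (index true u) b.

Definition clause_chunk (p : {set V} * {set V} * {set V}) u1 u2 u3 : seq bool :=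
  chunk (hit p.1.1 u1 :|: hit p.1.2 u2 :|: hit p.2 u3).

Definition clause_missed (p : {set V} * {set V} * {set V}) b1 b2 b3 u1 u2 u3 : bool :=
  [|| missed p.1.1 b1 u1, missed p.1.2 b2 u2 | missed p.2 b3 u3].

(** A counter digit has [a + 1] bits: the flag of the group, which is skipped here, and then its
    hash value. *)
Definition digit (u : seq bool) : a.-tuple bool := [tuple nth false u j.+1 | j < a].

Definition column_chunk (p : position k a * (a.-tuple bool * a.-tuple bool))
    (u : seq bool) : seq bool :=
  chunk (inl (p.1, digit u) |: if head false u then [set inr p] else set0).

Definition i0 : 'I_3 := @Ordinal 3 0 isT.
Definition i1 : 'I_3 := @Ordinal 3 1 isT.
Definition i2 : 'I_3 := @Ordinal 3 2 isT.

Definition sgn (t : 'I_3) (C : clause n) : bool := (tnth C t).2.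
Definition pos (t : 'I_3) (C : clause n) : seq bool := onehot (tnth C t).1.

Definition candidates : seq (seq bool) :=
  cands k a.+1 triples columns clause_chunk clause_missed column_chunk (head false)
    (sgn i0) (sgn i1) (sgn i2) (pos i0) (pos i1) (pos i2) m cs.

Lemma all_size_candidates : all_size N candidates.
Proof. by apply: all_size_cands => *; apply: size_chunk. Qed.

Lemma clause_bitsE (C : clause n) :
  clause_bits (sgn i0) (sgn i1) (sgn i2) (pos i0) (pos i1) (pos i2) C =
  flatten (map (@encode_literal n) C).
Proof.
case/tupleP: C => l0 C; case/tupleP: C => l1 C; case/tupleP: C => l2 C; rewrite (tuple0 C).
by rewrite /clause_bits /sgn /pos !(tnth_nth l0) /= cats0.
Qed.

Lemma encode_cnfE : encode_cnf cs = nseq n true ++ false ::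
  flatten (map (clause_bits (sgn i0) (sgn i1) (sgn i2) (pos i0) (pos i1) (pos i2)) cs).
Proof.
rewrite /encode_cnf; congr (_ ++ _ :: flatten _).
by apply: eq_map => C; rewrite clause_bitsE.
Qed.

(** The numbering [vx] puts the vertices of group [g] in the [g]-th chunk, in the order of
    [enum]. *)
Lemma encode_setE (e : {set 'I_N}) (S : nat -> {set V}) :
  encode_set e = flatten (mkseq (fun g => chunk (S g)) m) <->
  forall g : 'I_m, sec e g = S g.
Proof.
have sz f : all (fun u => size u == K) (mkseq (fun g => chunk (f g)) m).
  by apply/allP=> u /mapP[g _ ->]; rewrite size_chunk.
have sf f : size (flatten (mkseq (fun g => chunk (f g)) m)) = N.
  rewrite (@size_flatten_all K) ?size_mkseq // => u uM.
  exact/eqP/(allP (sz f)).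
have nE f (g : 'I_m) (u : V) :
    nth false (flatten (mkseq (fun g => chunk (f g)) m)) (vx g u) = (u \in f g).
  rewrite nth_flatten_block // ?nth_mkseq //.
  by rewrite (nth_map u) -?cardE // nth_enum_rank.
have eE (i : 'I_N) : nth false (encode_set e) i = (i \in e).
  by rewrite (nth_map i) ?size_enum_ord // nth_ord_enum.
split=> [E g|H].
  by apply/setP=> u; rewrite inE -eE E nE.
apply: (@eq_from_nth _ false); first by rewrite size_map size_enum_ord sf.
move=> i; rewrite size_map size_enum_ord => iN.
have [g [u Ei]] := vxK (Ordinal iN).
by rewrite -[i]/(val (Ordinal iN)) eE Ei nE -H inE.
Qed.

Definition hyperedges : {set {set 'I_N}} := [set e | encode_set e \in candidates].

Lemma hits_bigcup (S : 'I_3 -> {set V}) (C : clause n) (g : 'I_m) :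
  \bigcup_(t | grp k_gt0 mk1 (tnth C t).1 == g) S t =
  hit (S i0) (blk k (false :: pos i0 C) g) :|: hit (S i1) (blk k (false :: pos i1 C) g)
    :|: hit (S i2) (blk k (false :: pos i2 C) g).
Proof.
have hE t : hit (S t) (blk k (false :: pos t C) g) =
    if grp k_gt0 mk1 (tnth C t).1 == g then S t else set0.
  by rewrite /hit (blk_onehot _ _ k_gt0).1.
rewrite big_mkcond !big_ord_recl big_ord0 /= setU0 !hE setUA.
have -> : lift ord0 (lift ord0 ord0) = i2 :> 'I_3 by apply/val_inj.
have -> : lift ord0 ord0 = i1 :> 'I_3 by apply/val_inj.
by have -> : ord0 = i0 :> 'I_3 by apply/val_inj.
Qed.

Lemma missedE S t (C : clause n) :
  has (fun g => missed S (sgn t C) (blk k (false :: pos t C) g)) (iota 0 m) =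
  ~~ refutes S (slot k (tnth C t).1) (tnth C t).2.
Proof.
apply/hasP/idP => [[g _ /andP[]]|R].
  rewrite (blk_onehot _ _ k_gt0).1 => gE.
  by rewrite (blk_onehot _ _ k_gt0).2.
exists (val (grp k_gt0 mk1 (tnth C t).1)); first by rewrite mem_iota add0n ltn_ord.
by rewrite /missed (blk_onehot _ _ k_gt0).1 eqxx (blk_onehot _ _ k_gt0).2.
Qed.

Lemma rejectedE p (C : clause n) :
  rejected1 k clause_missed (sgn i0) (sgn i1) (sgn i2) (pos i0) (pos i1) (pos i2) m p C =
  [|| ~~ refutes p.1.1 (slot k (tnth C i0).1) (tnth C i0).2,
      ~~ refutes p.1.2 (slot k (tnth C i1).1) (tnth C i1).2 |
      ~~ refutes p.2 (slot k (tnth C i2).1) (tnth C i2).2].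
Proof.
by rewrite -!missedE -!has_predU; apply: eq_has.
Qed.

Definition choose3 (p : {set V} * {set V} * {set V}) (t : 'I_3) : {set V} :=
  if t == i0 then p.1.1 else if t == i1 then p.1.2 else p.2.

Lemma hyperedgesP e : e \in hyperedges <->
  clause_edge phi k_gt0 mk1 e \/ column_edge e.
Proof.
rewrite inE mem_cat; split.
  case/orP=> /flattenP[_ /mapP[p pP ->]].
    case/flattenP=> _ /mapP[C CP ->]; case: ifP => // /negbT.
    rewrite rejectedE !negb_or !negbK => /and3P[R0 R1 R2]; rewrite inE => /eqP E.
    left; exists C, (choose3 p); split.
    - by rewrite -mem_enum -(perm_mem csP).
    - move: pP; rewrite mem_filter => /andP[/and3P[P0 P1 P2] _].
      have t3 (t : 'I_3) : [\/ t = i0, t = i1 | t = i2].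
        case: t => -[|[|[|//]]] i; [apply: Or31|apply: Or32|apply: Or33]; exact: val_inj.
      by move=> t; case: (t3 t) => ->; rewrite /choose3 /= ?P0 ?P1 ?P2.
    move=> g; rewrite hits_bigcup.
    exact: ((encode_setE e (fun g => hit p.1.1 (blk k (false :: pos i0 C) g) :|:
      hit p.1.2 (blk k (false :: pos i1 C) g) :|: hit p.2 (blk k (false :: pos i2 C) g))).1 E g).
  rewrite /cands2; case: ifP => // acc /mapP[[h c] _ E]; right.
  exists h, c, (fun g => digit (blk a.+1 p g)), (fun g => head false (blk a.+1 p g)); split.
    case/hasP: acc => g; rewrite mem_iota add0n => gm hg; by exists (Ordinal gm).
  move=> g; exact: ((encode_setE e (fun g => inl (h, digit (blk a.+1 p g)) |:
    if head false (blk a.+1 p g) then [set inr (h, c)] else set0)).1 E g).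
case=> [[C [S [CP HS Hs]]]|[h [c [v [f [[g0 fg0] Hs]]]]]]; apply/orP; [left|right].
  apply/flatten_mapP; exists (S i0, S i1, S i2).
    rewrite mem_filter mem_enum /= andbT; apply/and3P.
    by split; [have := HS i0|have := HS i1|have := HS i2]; case/andP.
  apply/flatten_mapP; exists C.
    by rewrite (perm_mem csP) mem_enum.
  case: ifP; rewrite rejectedE /=.
    by case/or3P; [have := HS i0|have := HS i1|have := HS i2]; case/andP=> _ ->.
  move=> _; rewrite inE; apply/eqP.
  apply/(encode_setE e (fun g => hit (S i0) (blk k (false :: pos i0 C) g) :|:
    hit (S i1) (blk k (false :: pos i1 C) g) :|: hit (S i2) (blk k (false :: pos i2 C) g))) => g.
  by rewrite Hs hits_bigcup.
(* The digits of the counter value that produces the given column edge. *)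
pose Z : seq (seq bool) := [seq f g :: v g | g <- enum 'I_m].
have sZ : all (fun u => size u == a.+1) Z.
  by apply/allP=> _ /mapP[g _ ->]; rewrite /= size_tuple.
have zZ : size Z = m by rewrite size_map size_enum_ord.
have bZ (g : 'I_m) : blk a.+1 (flatten Z) g = f g :: v g.
  by rewrite blk_flatten ?zZ // (nth_map g) ?size_enum_ord // nth_ord_enum.
apply/flatten_mapP; exists (flatten Z).
  apply: mem_traject_incr; rewrite (@size_flatten_all a.+1) ?zZ 1?mulnC // => u uZ.
  exact/eqP/(allP sZ).
rewrite /cands2 ifT; last first.
  by apply/hasP; exists (val g0); rewrite ?mem_iota ?add0n ?ltn_ord // bZ.
apply/mapP; exists (h, c); first by rewrite mem_enum.
apply/(encode_setE e (fun g => inl (h, digit (blk a.+1 (flatten Z) g)) |: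
  if head false (blk a.+1 (flatten Z) g) then [set inr (h, c)] else set0)) => g.
rewrite Hs bZ /=; congr (inl (h, _) |: _).
by apply: eq_from_tnth => j; rewrite tnth_mktuple /= (tnth_nth false).
Qed.

Definition edge_words : seq (seq bool) := foldl ins [::] candidates.

Definition set_of_word (w : seq bool) : {set 'I_N} := [set i | nth false w (val i)].

Lemma encode_set_of_word w : size w = N -> encode_set (set_of_word w) = w.
Proof.
move=> sw; apply: (@eq_from_nth _ false); first by rewrite size_map size_enum_ord.
move=> i; rewrite size_map size_enum_ord => iN.
by rewrite (nth_map (Ordinal iN)) ?size_enum_ord // inE /= nth_enum_ord.
Qed.

Lemma encode_setK (e : {set 'I_N}) : set_of_word (encode_set e) = e.
Proof.
by apply/setP=> i; rewrite inE (nth_map i) ?size_enum_ord //= nth_ord_enum.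
Qed.

Lemma size_edge_words : all_size N edge_words.
Proof. by apply: all_size_foldl_ins => // e /all_size_candidates. Qed.

Lemma edge_words_perm : perm_eq (map set_of_word edge_words) (enum hyperedges).
Proof.
apply: uniq_perm; rewrite ?enum_uniq //.
  rewrite map_inj_in_uniq ?uniq_foldl_ins // => w w' /size_edge_words sw /size_edge_words sw' E.
  by rewrite -(encode_set_of_word sw) E encode_set_of_word.
move=> e; rewrite mem_enum inE; apply/mapP/idP => [[w wE ->]|eC].
  rewrite encode_set_of_word; last exact: size_edge_words.
  by move: wE; rewrite mem_foldl_ins.
by exists (encode_set e); rewrite ?encode_setK // mem_foldl_ins.
Qed.

Lemma encode_hypergraph_words : encode_hypergraph (map set_of_word edge_words) =
  nseq N true ++ false :: flatten edge_words.
Proof.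
rewrite /encode_hypergraph -map_comp; congr (_ ++ _ :: flatten _).
rewrite -[RHS]map_id; apply/eq_in_map=> w /size_edge_words /=.
exact: encode_set_of_word.
Qed.

Lemma size_candidates :
  size candidates <= size triples * size cs + 2 ^ (m * a.+1) * size columns.
Proof.
rewrite size_cat; apply: leq_add.
  elim: triples => //= p l IH; rewrite size_cat mulSn leq_add //.
  by elim: (cs) => //= C l' IH'; rewrite size_cat (@leq_add _ _ 1) //; case: ifP.
apply: (@leq_trans (size (traject incr (nseq (m * a.+1) false) (2 ^ (m * a.+1)))
  * size columns)); last by rewrite size_traject.
elim: (traject _ _ _) => //= z l IH; rewrite size_cat mulSn leq_add //.
by rewrite /cands2; case: ifP => // _; rewrite size_map.
Qed.

End Link.

(** * The machine that solves 3-SAT *)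

Section Solver.
Variables (M : tm) (k a : nat).

Notation K := (12 + tm_work M).

(** The bound per group: [2 |position| A] with [A = 2 ^ a], against [|position| A ^ 2] for
    satisfiable formulas, a ratio of [A / 2]. *)
Definition threshold : nat := 2 * (#|position k a| * 2 ^ a).

Definition reduction : cmd :=
  Reduce k a.+1 (gsize k a) threshold (triples k a) (columns k a)
    (@clause_chunk k a) (@clause_missed k a) (@column_chunk k a) (head false).

(** Tape [0] of [M] is [rOUT], where the reduction leaves the hypergraph and [Decide] reads the
    answer. The work tapes of [M] lie beyond the registers. *)
Definition tape_of (i : 'I_(tm_work M).+1) : 'I_K.+1 := inord (12 + i).

Lemma tape_ofE i : tape_of i = 12 + i :> nat.
Proof. by rewrite inordK // -addnS leq_add2l. Qed.

Lemma tape_of_inj : injective tape_of.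
Proof.
move=> i j /(congr1 val); rewrite /= !tape_ofE => /addnI; exact: val_inj.
Qed.

Definition solver_mach : mach K :=
  mseq (compile K reduction) (mseq (mlift tape_of) (compile K Decide)).

Definition solver : tm := tm_of solver_mach.

Lemma fits_reduction : fits K 3 reduction.
Proof. by apply: fits_Reduce; rewrite leq_addr. Qed.

Lemma fits_decide : fits K 1 Decide.
Proof. by apply: fits_Decide; rewrite leq_addr. Qed.

Lemma wp_ev B c Q s : wp B c Q s -> exists2 s', ev B c s = Some s' & Q s'.
Proof. by rewrite /wp; case: (ev B c s) => // s' Qs; exists s'. Qed.

Variables (m n : nat) (cs : seq (clause n)) (B : nat).
Hypothesis k_gt0 : 0 < k.
Hypothesis mk : n.+1 <= m * k < n.+1 + k.

Notation N := (gsize k a * m).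

Lemma gsize_gt0 : 0 < gsize k a.
Proof.
by apply/card_gt0P; exists (inl ([ffun=> [tuple of nseq a false]], [tuple of nseq a false])).
Qed.

Lemma solver_decides (tM : nat) (F : {set 'I_N})
    (x := encode_hypergraph (map (@set_of_word k a m) (edge_words k a m cs))) :
  size (encode_cnf cs) <= B -> m * a.+1 < B -> 2 ^ (m * a.+1) <= B -> N <= B ->
  N * size (candidates k a m cs) <= B ->
  halts_within M x tM -> (forall w : tM.-tuple bool, output (exec M x w) = encode_set F) ->
  decides_within solver (encode_cnf cs)
    (cost B reduction + (tM + cost B Decide)) (threshold * m < #|F|).
Proof.
move=> szB lB pB NB cB hM oM; set T := (_ + (_ + _)).
set t0 := (init solver (encode_cnf cs)).2.
rewrite encode_cnfE in szB t0 *; set y := flatten _ in szB t0 *.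
move: szB; rewrite size_cat size_nseq /= => szB.
have yB : size y <= B by lia.
have nB : n < B by lia.
have sp t C : size (@pos n t C) = n by apply: size_onehot.
have [s1 E1 Es1] : exists2 s', ev B reduction
     [:: nseq n true ++ false :: y; [::]; [::]; [::]; [::]; [::]; [::]; [::]; [::]; [::]; [::];
     [::]; [::]] = Some s' &
   s' = [:: [::]; nseq (threshold * m) true; [::]; [::]; [::]; [::]; [::];
     [::]; [::]; [::]; [::]; [::];
     nseq N true ++ false :: flatten (edge_words k a m cs)].
  apply: wp_ev; apply: wp_reduce => //; try exact: gsize_gt0; move=> *; exact: size_chunk.
have R0 : represents (K := K) clean_stack t0 [:: nseq n true ++ false :: y; [::]; [::]; [::];
     [::]; [::]; [::]; [::]; [::]; [::]; [::]; [::]; [::]].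
  move=> i; rewrite /t0 /init /clean_stack /= -val_eqE /=.
  case: (val i) => [|i'] //=; case: i' => [|[|[|[|[|[|[|[|[|[|[|[|j]]]]]]]]]]]] //=.
  by rewrite /reg /= nth_nil.
have [t1 X1 R1] := compile_exits clean_stack_scan clean_stack_pop clean_stack_push
  clean_stack_idle fits_reduction E1 R0.
rewrite Es1 in R1.
have Hi i : clean_stack (t1 (tape_of i)) (if i == ord0 then x else [::]).
  have := R1 (tape_of i); rewrite tape_ofE /x encode_hypergraph_words -val_eqE /=.
  by case: (val i) => [|j] //=; rewrite /reg /= nth_nil.
have [t2 [X2 O2 J2]] := mlift_exits tape_of_inj hM oM Hi.
(* Whatever [M] leaves on its work tapes becomes the content of the registers after [rOUT]. *)
pose junk := mkseq (fun j => bits (t2 (inord (13 + j))).2) (tm_work M).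
have sF : size (encode_set F) <= B by rewrite size_map size_enum_ord.
have [s3 E3 Es3] := wp_ev (wp_decide (threshold * m) junk sF).
have R2 : represents (K := K) stack t2 [:: [::], nseq (threshold * m) true, [::], [::], [::],
    [::], [::], [::], [::], [::], [::], [::], encode_set F & junk].
  move=> i; have [i12|i12] := ltnP i 12.
    rewrite /stack J2.
      have /clean_stackW := R1 i; rewrite /stack => ->.
      by move: (val i) i12 => [|[|[|[|[|[|[|[|[|[|[|[|j]]]]]]]]]]]].
    by move=> j; rewrite -val_eqE /= tape_ofE; lia.
  have [i12'|i12'] := eqVneq (val i) 12.
    have -> : i = tape_of ord0 by apply/val_inj; rewrite /= tape_ofE.
    by rewrite tape_ofE.
  have iE : val i = 13 + (i - 13) by move: i12'; rewrite /=; lia.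
  rewrite /stack /reg [X in nth _ _ X]iE /= nth_mkseq.
    by congr (bits (t2 _).2); rewrite -iE inord_val.
  by have := ltn_ord i; move: i12'; rewrite /=; lia.
have [t3 X3 R3] := compile_exits stack_scan stack_pop stack_push
  stack_idle fits_decide E3 R2.
have X : exits (mstart solver_mach) t0 T t3.
  by apply: mseq_exits X1 _; apply: mseq_exits X2 X3.
have HX : iter T (@mstep _ solver_mach) (mstart solver_mach, t0) = (None, t3).
  case: X => n' le; rewrite -(subnK le) iterD => ->; exact: iter_mstep_None.
have cF : count id (encode_set F) = #|F|.
  by rewrite count_map cardE size_filter enumT; apply: eq_count.
have HT (w : T.-tuple bool) : exec solver (nseq n true ++ false :: y) w = (None, t3).
  by rewrite exec_tm_of size_tuple.
split=> [w|]; first by rewrite HT.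
(* All coin sequences give the right answer, so the success probability is 1. *)
rewrite [X in _ <= 3 * X](_ : _ = 2 ^ T); first by rewrite leq_mul2r orbT.
have <- : #|[set: T.-tuple bool]| = 2 ^ T by rewrite cardsT card_tuple card_bool.
congr #|pred_of_set _|; apply/setP=> w.
rewrite !inE HT /output /=; have := R3 ord0.
by rewrite /stack [reg _ _]Es3 cF => ->; rewrite eqxx.
Qed.

End Solver.

(** * Asymptotics *)

Section Asymptotics.
Import Order.TTheory GRing.Theory Num.Theory.
Local Open Scope ring_scope.
Variable R : realType.
Implicit Types (s r eps eta x y u : R).

Lemma powR_expR x y : 0 < x -> x `^ y = expR (y * ln x).
Proof. by move=> x0; rewrite /powR gt_eqF. Qed.

(** With [b = (1 - s) / 2], [u <= expR (b * u) / b] bounds the left side by [expR (u - b * u) / b].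
    Either [expR (- (b * u)) <= eta * b], which gives the first term, or [u <= l / b], which gives
    the constant. *)
Lemma sublinear_mul_expR s eta : 0 <= s < 1 -> 0 < eta ->
  exists D, forall u, 0 <= u -> u * expR (s * u) <= eta * expR u + D.
Proof.
move=> /andP[s0 s1] eta0; pose b := (1 - s) / 2.
have b0 : 0 < b by rewrite /b; lra.
have eb0 : 0 < eta * b by rewrite mulr_gt0.
pose l := ln ((eta * b)^-1).
exists (b^-1 * expR (l / b)) => u u0.
have uE : u <= b^-1 * expR (b * u).
  rewrite -ler_pdivrMl ?invr_gt0 // invrK.
  by apply: le_trans (expR_ge1Dx (b * u)); rewrite lerDr.
have H1 : u * expR (s * u) <= b^-1 * expR ((1 - b) * u).
  apply: le_trans (_ : b^-1 * expR (b * u) * expR (s * u) <= _).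
    by rewrite ler_wpM2r ?expR_ge0.
  rewrite -mulrA -expRD le_eqVlt; apply/orP; left; apply/eqP; congr (_ * expR _).
  by rewrite /b; field.
apply: le_trans H1 _.
have [H|H] := lerP (expR (- (b * u))) (eta * b).
  have -> : (1 - b) * u = u + - (b * u) by ring.
  rewrite expRD mulrCA; apply: le_trans (_ : expR u * (b^-1 * (eta * b)) <= _).
    by rewrite ler_wpM2l ?expR_ge0 // ler_wpM2l // invr_ge0 ltW.
  have -> : expR u * (b^-1 * (eta * b)) = eta * expR u by field; rewrite gt_eqF.
  by rewrite lerDl mulr_ge0 ?expR_ge0 // invr_ge0 ltW.
apply: le_trans (_ : b^-1 * expR (l / b) <= _); last by rewrite lerDr mulr_ge0 ?expR_ge0 // ltW.
rewrite ler_wpM2l ?invr_ge0 ?(ltW b0) // ler_expR.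
have H2 : b * u <= l.
  rewrite -ler_expR /l lnK ?posrE ?invr_gt0 //.
  by rewrite -[leLHS]invrK lef_pV2 ?posrE ?invr_gt0 ?expR_gt0 // -expRN ltW.
have bl : u <= l / b by rewrite ler_pdivlMr // mulrC.
by apply: le_trans bl; rewrite ler_piMl //; lra.
Qed.

Lemma sublinear_ln eta : 0 < eta -> exists D, forall n : nat, ln n.+1%:R <= eta * n%:R + D.
Proof.
move=> eta0; have [|D HD] := @sublinear_mul_expR 0 eta _ eta0; first by rewrite lexx ltr01.
exists (eta + D) => n; have n1 : (1 : R) <= n.+1%:R by rewrite ler1n.
have := HD (ln n.+1%:R) (ln_ge0 n1); rewrite mul0r expR0 mulr1 lnK ?posrE ?ltr0n //.
by rewrite -natr1; lra.
Qed.

Lemma sublinear_exponent r eps eta : 1 < r -> 0 < eps -> 0 < eta ->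
  exists D, forall y, 1 <= y -> (y / r) `^ (1 - eps) * ln y <= eta * y + D.
Proof.
(* The substitution is [u = ln y]. The maximum covers [eps > 1], and [c] bounds the factor [r] to
   the power [- (1 - eps)]. *)
move=> r1 eps0 eta0; pose s := Num.max 0 (1 - eps).
have r0 : 0 < r by apply: lt_trans r1.
have s01 : 0 <= s < 1 by rewrite /s le_max lexx /= gt_max ltr01 /=; lra.
pose c := expR (`|1 - eps| * ln r).
have c0 : 0 < c by apply: expR_gt0.
have lr : 0 <= ln r by apply/ln_ge0/ltW.
have [D HD] := @sublinear_mul_expR s (eta / c) s01 (divr_gt0 eta0 c0).
exists (c * D) => y y1; have y0 : 0 < y by apply: lt_le_trans y1.
have ly := ln_ge0 y1.
have H : (y / r) `^ (1 - eps) <= c * expR (s * ln y).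
  rewrite powR_expR ?divr_gt0 // ln_div ?posrE // -expRD ler_expR mulrBr addrC.
  apply: lerD; first by rewrite -mulNr ler_wpM2r // -normrN ler_norm.
  by rewrite ler_wpM2r // /s le_max lexx orbT.
apply: le_trans (ler_wpM2r ly H) _.
have := HD _ ly; rewrite lnK ?posrE // => {}HD.
apply: le_trans (_ : c * (eta / c * y + D) <= _).
  rewrite -[leLHS]mulrA; apply: ler_wpM2l; first exact: ltW.
  by rewrite mulrC.
rewrite mulrDr lerD2r le_eqVlt; apply/orP; left; apply/eqP; field.
by rewrite gt_eqF.
Qed.

(* The running time of the solver: [B] bounds the loops of its programs, and [N] is
   the number of vertices of the hypergraph. *)
Lemma solver_time_bound r eps delta (d k a1 K c : nat) :
  1 < r -> 0 < eps -> 0 < delta -> (0 < k)%N ->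
  4 * d%:R * a1%:R <= delta * k%:R ->
  exists D, 0 <= D /\ forall (n B N : nat),
    (B.+1 <= c * n.+1 ^ 4 * 2 ^ ((n %/ k).+1 * a1))%N -> (0 < N <= K * n.+1)%N ->
    B.+1%:R ^+ d * (1 + N%:R `^ ((N%:R / r) `^ (1 - eps))) <= D * 2 `^ (delta * n%:R) :> R.
Proof.
move=> r1 eps0 delta0 k0 Hk.
have l2 : 0 < ln 2 :> R by apply: ln_gt0; rewrite ltr1n.
(* The exponent [delta n ln 2] is split into four shares [e n]; the polynomial factor, the number of
   counter values and the approximation algorithm take one each. *)
pose e := delta * ln 2 / 4.
have e0 : 0 < e by rewrite divr_gt0 // mulr_gt0.
have [|D1 HD1] := @sublinear_ln (e / (4 * d%:R + 1)).
  by rewrite divr_gt0 // ltr_wpDl // mulr_ge0.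
have [|D2 HD2] := @sublinear_exponent r eps (e / (K%:R + 1)) r1 eps0.
  by rewrite divr_gt0 // ltr_wpDl.
pose D3 := `|D1| * (4 * d%:R + 1) + (`|D2| + e) + d%:R * a1%:R * ln 2.
exists (2 * (c%:R ^+ d * expR D3)); split.
  by rewrite mulr_ge0 // mulr_ge0 ?expR_ge0 // exprn_ge0.
move=> n B N HB /andP[N0 NK].
have n0 : 0 <= n%:R :> R by rewrite ler0n.
set T := N%:R `^ _.
have N1 : 1 <= N%:R :> R by rewrite ler1n.
have T1 : 1 <= T.
  rewrite /T powR_expR ?ltr0n // -[leLHS]expR0 ler_expR mulr_ge0 ?powR_ge0 //.
  exact: (ln_ge0 N1).
have HT : T <= expR (e * n%:R + (`|D2| + e)).
  rewrite /T powR_expR ?ltr0n // ler_expR; apply: le_trans (HD2 _ N1) _.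
  have : e / (K%:R + 1) * N%:R <= e * n.+1%:R.
    rewrite -mulrA ler_wpM2l ?(ltW e0) // mulrC ler_pdivrMr ?ltr_wpDl //.
    apply: le_trans (_ : (K * n.+1)%:R <= _); first by rewrite ler_nat.
    by rewrite natrM mulrC ler_wpM2l // lerDl.
  by rewrite -natr1; have := ler_norm D2; lra.
have HBR : B.+1%:R ^+ d <= c%:R ^+ d *
    expR (e * n%:R + `|D1| * (4 * d%:R + 1) + (e * n%:R + d%:R * a1%:R * ln 2)).
  apply: le_trans (_ : (c%:R * expR (4 * ln n.+1%:R) *
      expR (((n %/ k).+1 * a1)%:R * ln 2)) ^+ d <= _).
    apply: lerXn2r; rewrite ?nnegrE ?mulr_ge0 ?expR_ge0 //.
    apply: le_trans (_ : (c * n.+1 ^ 4 * 2 ^ ((n %/ k).+1 * a1))%:R <= _).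
      by rewrite ler_nat.
    rewrite (expRM_natl 4) (expRM_natl ((n %/ k).+1 * a1)) !natrM !natrX.
    by rewrite !lnK ?posrE ?ltr0n.
  rewrite -mulrA exprMn -expRD ler_wpM2l ?exprn_ge0 // -expRM_natl ler_expR mulrDr.
  apply: lerD.
    have := HD1 n; set ll := ln _ => Hll.
    have ll0 : 0 <= ll by apply: ln_ge0; rewrite ler1n.
    apply: le_trans (_ : (4 * d%:R + 1) * ll <= _).
      by rewrite mulrA (mulrC _ 4) ler_wpM2r // lerDl.
    apply: le_trans (_ : (4 * d%:R + 1) * (e / (4 * d%:R + 1) * n%:R + `|D1|) <= _).
      rewrite ler_wpM2l // ?addr_ge0 ?mulr_ge0 //.
      by apply: le_trans Hll _; rewrite lerD2l ler_norm.
    rewrite le_eqVlt; apply/orP; left; apply/eqP; field.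
    by rewrite gt_eqF // ltr_wpDl // mulr_ge0.
  (* The successor in the number of groups costs the constant [d a1 ln 2], which goes to [D3]; [Hk]
     bounds the rest. *)
  rewrite natrM -natr1.
  have q : (n %/ k)%:R * k%:R <= n%:R :> R by rewrite -natrM ler_nat leq_divM.
  have q0 : 0 <= (n %/ k)%:R :> R by rewrite ler0n.
  have : d%:R * a1%:R * (n %/ k)%:R * 4 <= delta * n%:R.
    apply: le_trans (_ : delta * ((n %/ k)%:R * k%:R) <= _); last by rewrite ler_wpM2l // ltW.
    have := ler_wpM2r q0 Hk; lra.
  move=> /(ler_wpM2r (ltW l2)) => Hq; rewrite /e; lra.
rewrite powR_expR ?ltr0n //.
apply: le_trans (_ : c%:R ^+ d * expR (e * n%:R + `|D1| * (4 * d%:R + 1) +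
   (e * n%:R + d%:R * a1%:R * ln 2)) * (2 * expR (e * n%:R + (`|D2| + e))) <= _).
  apply: ler_pM; rewrite ?exprn_ge0 //; first by rewrite addr_ge0 ?powR_ge0.
  by rewrite mulrDl !mul1r; apply: lerD => //; apply: le_trans HT.
have c2 : 0 <= 2 * c%:R ^+ d :> R by rewrite mulr_ge0 // exprn_ge0.
suff /(ler_wpM2l c2) : expR (e * n%:R + `|D1| * (4 * d%:R + 1) +
    (e * n%:R + d%:R * a1%:R * ln 2)) * expR (e * n%:R + (`|D2| + e)) <=
    expR D3 * expR (delta * n%:R * ln 2).
  by congr (_ <= _); ring.
rewrite -!expRD ler_expR /D3.
have : 0 <= e * n%:R by rewrite mulr_ge0 // ltW.
have -> : delta * n%:R * ln 2 = 4 * (e * n%:R) by rewrite /e; field.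
move: (e * n%:R) => X; lra.
Qed.

End Asymptotics.

(** * The number of groups and the fuel *)

Lemma groups_bounds k n : 0 < k -> n.+1 <= (n %/ k).+1 * k < n.+1 + k.
Proof.
move=> k0; have := divn_eq n k; have := ltn_pmod n k0; rewrite mulSn.
by move: (n %/ k * k) (n %% k) => x y; lia.
Qed.

Section Fuel.
Variables (k a n : nat) (phi : {set clause n}) (cs : seq (clause n)).
Notation m := (n %/ k).+1.
Notation K := (gsize k a).
Notation N := (K * m).

(** A sum that dominates every quantity that [solver_decides] requires to be at most [B]. *)
Definition fuel : nat :=
  size (encode_cnf cs) + (m * a.+1).+1 + 2 ^ (m * a.+1) + N +
  N * (size (triples k a) * size cs + 2 ^ (m * a.+1) * size (columns k a)).

(** With at most [8 (n + 1) ^ 3] clauses, the formula contributes [1 + 3 * 8]; the length of the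
    counter, the number of its values and the successor in [fuel.+1] contribute one each, in total
    28. *)
Definition fuel_factor : nat :=
  28 + K + K * (8 * size (triples k a) + size (columns k a)).

Lemma size_encode_cnf : size (encode_cnf cs) = n.+1 + 3 * n.+1 * size cs.
Proof.
rewrite (encode_cnfE cs) size_cat size_nseq /= addnS -addSn; congr (_ + _).
rewrite (@size_flatten_all (3 * n.+1)) ?size_map // => e /mapP[C _ ->].
by rewrite /clause_bits !size_cat /= !size_onehot; lia.
Qed.

Lemma fuel_geq : [/\ size (encode_cnf cs) <= fuel, m * a.+1 < fuel,
  2 ^ (m * a.+1) <= fuel & N <= fuel].
Proof.
have H x1 x2 x3 x4 x5 (s := x1 + x4.+1 + x3 + x2 + x5) :
  [/\ x1 <= s, x4 < s, x3 <= s & x2 <= s] by rewrite /s; split; lia.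
exact: H.
Qed.

Lemma candidates_fuel : N * size (candidates k a m cs) <= fuel.
Proof.
rewrite /fuel; apply: leq_trans (leq_addl _ _).
by rewrite leq_mul2l size_candidates orbT.
Qed.

Lemma hypergraph_fuel :
  size (encode_hypergraph (map (@set_of_word k a m) (edge_words k a m cs))) <= fuel.+1.
Proof.
rewrite encode_hypergraph_words size_cat size_nseq /=.
rewrite (size_flatten_all (@size_edge_words k a m n cs)).
have := size_foldl_ins (candidates k a m cs) [::]; rewrite -/(edge_words k a m cs) add0n => le1.
have : N * size (edge_words k a m cs) <=
    N * (size (triples k a) * size cs + 2 ^ (m * a.+1) * size (columns k a)).
  by rewrite leq_mul2l (leq_trans le1 (size_candidates _ _ _ _)) orbT.
move=> H; rewrite addnS ltnS; apply: leq_trans (leq_add (leqnn N) H) _.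
by rewrite /fuel leq_add2r leq_addl.
Qed.

Hypothesis csP : perm_eq cs (enum phi).

Lemma size_cnf : size cs <= 8 * n.+1 ^ 3.
Proof.
rewrite (perm_size csP) -cardE; apply: leq_trans (max_card _) _.
by rewrite card_tuple card_prod card_ord card_bool expnMn mulnC leq_mul // leq_exp2r.
Qed.

Lemma fuel_bound : fuel.+1 <= fuel_factor * n.+1 ^ 4 * 2 ^ (m * a.+1).
Proof.
rewrite /fuel /fuel_factor size_encode_cnf.
have := size_cnf; move: (size cs) (size (triples k a)) (size (columns k a)) => s tri col hs.
have PL := ltn_expl (m * a.+1) (isT : 1 < 2).
set P := 2 ^ (m * a.+1) in PL *; set L := m * a.+1 in PL *.
have mX : m <= n.+1 by rewrite ltnS leq_div.
have NX : N <= K * n.+1 by rewrite leq_mul2l mX orbT.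
move: NX; move: (N) => N0; move: (K) => K0 NX.
set X := n.+1 in hs NX *.
have X0 : 0 < X by [].
have P0 : 0 < P by rewrite /P expn_gt0.
have X3 : 0 < X ^ 3 by rewrite expn_gt0.
have X4 : X ^ 4 = X * X ^ 3 by rewrite -expnS.
move: (X ^ 3) (X ^ 4) hs X3 X4 => x3 x4 hs X3 ->.
set Y := X * x3 * P; rewrite -[leqRHS]mulnA -/Y.
have h1 : X <= Y by rewrite /Y -mulnA leq_pmulr // muln_gt0 X3.
have h2 : X * s <= 8 * Y.
  apply: (@leq_trans (X * (8 * x3))); first by rewrite leq_mul2l hs orbT.
  by rewrite mulnCA leq_mul2l /= /Y leq_pmulr.
have h3 : P <= Y by rewrite /Y leq_pmull // muln_gt0 X0.
have h4 : N0 <= K0 * Y by apply: leq_trans NX _; rewrite leq_mul2l h1 orbT.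
have h5 : N0 * (tri * s) <= K0 * tri * (8 * Y).
  apply: (@leq_trans (K0 * X * (tri * s))); first by rewrite leq_mul2r NX orbT.
  by rewrite -mulnA (mulnCA X) mulnA leq_mul2l h2 orbT.
have h6 : N0 * (P * col) <= K0 * col * Y.
  apply: (@leq_trans (K0 * X * (P * col))); first by rewrite leq_mul2r NX orbT.
  rewrite -mulnA (mulnA X) (mulnC _ col) mulnA leq_mul2l; apply/orP; right.
  by rewrite /Y leq_mul2r leq_pmulr ?orbT.
rewrite mulnDr.
have -> : (28 + K0 + K0 * (8 * tri + col)) * Y =
    28 * Y + K0 * Y + K0 * tri * (8 * Y) + K0 * col * Y by ring.
have -> : 3 * X * s = 3 * (X * s) by rewrite mulnA.
lia.
Qed.

End Fuel.

(** * Choice of the parameters and conclusion *)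

Import Order.TTheory GRing.Theory Num.Theory.
Local Open Scope ring_scope.

Theorem theorem6 (R : realType) (eps : R) (heps : 0 < eps) :
  exists r0 : R, forall r : R, 1 < r -> r0 <= r ->
    (exists M : tm,
       MMHS_approx_in_time r (fun n => n%:R `^ ((n%:R / r) `^ (1 - eps))) M) ->
    ~ randomized_ETH R.
Proof.
(* The value 1 works because [a] and [k] are chosen after [r]. *)
exists 1 => r r1 _ [M [_ [C [d HM]]]] [delta [delta0]]; apply.
have r0 : 0 < r by apply: lt_trans r1.
(* This makes the ratio [A / 2] of the two cases exceed [r]. *)
pose a := Num.bound (2 * r).
have ra : 2 * r < (2 ^ a)%:R.
  apply: (@lt_trans _ _ a%:R); last by rewrite ltr_nat ltn_expl.
  by apply: archi_boundP; rewrite mulr_ge0 // ltW.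
(* The exponent [d] comes from the approximation algorithm and 3 from the loops of the reduction. As
   [d'] does not depend on [k], [k] can then be chosen large enough for it. *)
pose d' := (d + 3)%N.
pose k := (Num.bound (4 * d'%:R * a.+1%:R / delta)).+1.
have k0 : (0 < k)%N by [].
have Hk : 4 * d'%:R * a.+1%:R <= delta * k%:R.
  rewrite [leRHS]mulrC -ler_pdivrMr //; apply: (@le_trans _ _ k.-1%:R); last by rewrite ler_nat.
  by apply/ltW/archi_boundP; rewrite divr_ge0 ?mulr_ge0 // ltW.
have [C1 HC1] := cost_poly (fits_reduction M k a).
have [C2 HC2] := cost_poly (fits_decide M).
have [D [D0 HD]] := solver_time_bound (gsize k a) (fuel_factor k a) r1 heps delta0 k0 Hk.
exists (solver M k a), ((C1%:R + C2%:R + `|C|) * D) => n phi cs csP.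
pose m := (n %/ k).+1; pose N := (gsize k a * m)%N; pose B := fuel k a cs.
have mk := groups_bounds n k0.
have N0 : (0 < N)%N by rewrite muln_gt0 gsize_gt0.
have EP := @hyperedgesP k a m n phi cs k0 mk csP.
have [t [F [tle hM oM mF optF]]] := HM N (hyperedges k a m cs) _ N0 (set0_notin_E EP)
  (edge_words_perm k a m cs).
set x := encode_hypergraph _ in tle hM oM.
exists (cost B (reduction k a) + (t + cost B Decide))%N; split.
  set T := N%:R `^ _ in tle.
  have T0 : 0 <= T by apply: powR_ge0.
  have B1 : 1 <= B.+1%:R :> R by rewrite ler1n.
  have B0 : 0 <= B.+1%:R :> R by rewrite ler0n.
  (* [C] may be negative, hence the absolute value; the encoded hypergraph has at most [B + 1]
     bits. *)
  have tM : t%:R <= `|C| * (B.+1%:R ^+ d' * T).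
    apply: le_trans tle _; apply: le_trans (_ : `|C| * (size x)%:R ^+ d * T <= _).
      by rewrite ler_wpM2r // ler_wpM2r ?exprn_ge0 // ler_norm.
    rewrite -mulrA ler_wpM2l // ler_wpM2r //.
    apply: le_trans (_ : B.+1%:R ^+ d <= _); last by rewrite ler_weXn2l // leq_addr.
    by rewrite lerXn2r ?nnegrE // ler_nat hypergraph_fuel.
  have cR j Cj c : (j <= d')%N -> (cost B c <= Cj * B.+1 ^ j)%N ->
      (cost B c)%:R <= Cj%:R * B.+1%:R ^+ d' :> R.
    move=> jd le; apply: le_trans (_ : (Cj * B.+1 ^ j)%:R <= _); first by rewrite ler_nat.
    by rewrite natrM natrX ler_wpM2l // ler_weXn2l.
  have c1 := cR _ _ _ (leq_addl d 3) (HC1 B).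
  have c2 := cR _ _ _ (leq_trans (isT : (1 <= 3)%N) (leq_addl d 3)) (HC2 B).
  have := HD n B N (fuel_bound k a csP); rewrite N0 /= leq_mul2l ltnS leq_div orbT.
  move=> /(_ isT); rewrite -/T => HDn.
  rewrite natrD (natrD _ t) -[leRHS]mulrA.
  apply: le_trans (_ : (C1%:R + C2%:R + `|C|) * (B.+1%:R ^+ d' * (1 + T)) <= _); last first.
    by apply: ler_wpM2l => //; rewrite !addr_ge0.
  have Bd : 0 <= B.+1%:R ^+ d' :> R by rewrite exprn_ge0.
  have p1 : 0 <= C1%:R * B.+1%:R ^+ d' * T by rewrite !mulr_ge0.
  have p2 : 0 <= C2%:R * B.+1%:R ^+ d' * T by rewrite !mulr_ge0.
  have p3 : 0 <= `|C| * B.+1%:R ^+ d' by rewrite mulr_ge0.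
  move: c1 c2 tM p1 p2 p3; move: (B.+1%:R ^+ d') (cost B _)%:R (cost B _)%:R t%:R => b x1 x2 x3.
  move: C1%:R C2%:R `|C| => y1 y2 y3. lra.
have -> : satisfiable phi = (threshold k a * m < #|F|)%N.
  (* For a satisfiable formula the optimum is at least [|position| A ^ 2 m], and [A > 2 r], so even
     the optimum divided by [r] exceeds the threshold. *)
  apply/idP/idP => [sat|]; last exact: (opt_satisfiable EP).
  have := satisfiable_opt EP sat; rewrite -(ler_nat R) => optN.
  rewrite -(ltr_nat R); apply: lt_le_trans optF; rewrite ltr_pdivlMr //.
  apply: lt_le_trans optN; rewrite /threshold !natrM.
  have q0 : 0 < #|position k a|%:R :> R.
    by rewrite ltr0n; apply/card_gt0P; exists [ffun=> [tuple of nseq a false]].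
  have m0 : 0 < m%:R :> R by rewrite ltr0n.
  have A0 : 0 < (2 ^ a)%:R :> R by rewrite ltr0n expn_gt0.
  have := mulr_gt0 (mulr_gt0 q0 m0) A0; rewrite -subr_gt0 in ra.
  move=> /(mulr_gt0 ra); rewrite -subr_gt0; move: (_%:R) => z; lra.
have [B1 B2 B3 B4] := fuel_geq k a cs.
by apply: (solver_decides k0 mk) => //; apply: candidates_fuel.
Qed.
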